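(* Let $\mathbb{X}$ be a random cubical filtration in $\mathbb{R}^d$ that is stationary and $R$-dependent for some integer $R\ge0$, and fix an integer $0\le q<d$. Then there exists a Radon measure $\widehat\xi_q$ on $\Delta$ such that $\mathbb{E}[\xi_q^{\mathbb{X}^n}]/|\Lambda^n|$ converges vaguely to $\widehat\xi_q$ as $n\to\infty$, and almost surely $\xi_q^{\mathbb{X}^n}/|\Lambda^n|$ converges vaguely to $\widehat\xi_q$ as $n\to\infty$.
   Context: Fix $d\in\mathbb{N}$. Elementary cubes, cubical sets, (bounded) cubical filtrations $\{X(t)\}_{t\ge0}$ (increasing, right-continuous: $X(t)=\bigcap_{t'>t}X(t')$), real-coefficient cubical homology, birth times $t^{\mathbb{X}}_Q=\inf\{t: Q\subset X(t)\}$, random cubical filtrations (measurable w.r.t. the $\sigma$-field generated by birth times), stationarity (translations by $z\in\mathbb{Z}^d$ preserve the law of $\{t^{\mathbb{X}}_Q\}_Q$) and $R$-dependence (birth-time families of cubes in sets at max-norm distance $>R$ are independent) are as usual. $\Lambda^n=[-n,n]^d$, $|\Lambda^n|=(2n)^d$, $\mathbb{X}^n=\{X(t)\cap\Lambda^n\}_{t\ge0}$. $\Delta=\{(s,t)\in[0,\infty]^2:0\le s<t\le\infty\}$, topologized as homeomorphic to $\{(x,y):0\le x<y\le1\}$. For a bounded cubical filtration $\mathbb{X}$, the $q$th persistence diagram $\xi_q^{\mathbb{X}}=\sum_i\delta_{(b_i,d_i)}$ is the counting measure on $\Delta$ of the $q$th birth–death pairs (from the decomposition $\bigoplus_{t}H_q(X(t))\cong\bigoplus_i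 (z^{b_i})/(z^{d_i})$ as graded $\mathbb{R}[\{z^t\}_{t\ge0}]$-modules); equivalently it is the unique counting measure with $\xi_q^{\mathbb{X}}([0,s]\times(t,\infty])=\beta_q^{\mathbb{X}}(s,t)$ (rank of $H_q(X(s))\to H_q(X(t))$) for all $0\le s\le t<\infty$. $\mathcal{M}(\Delta)$ is the space of Radon measures on $\Delta$ with the vague topology (weakest making $\xi\mapsto\int f\,d\xi$ continuous for all compactly supported continuous $f$). $\mathbb{E}[\xi](A):=\mathbb{E}[\xi(A)]$. *)

(* Defs.v *)
From HB Require Import structures.
From mathcomp Require Import all_boot all_order all_algebra.
From mathcomp Require Import all_classical all_reals all_analysis.
From mathcomp Require Import measurable_realfun.
Set Implicit Arguments. Unset Strict Implicit. Unset Printing Implicit Defensive.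
Import Order.TTheory GRing.Theory Num.Theory.
Import numFieldNormedType.Exports.
Local Open Scope classical_set_scope.
Local Open Scope ring_scope.

(* An elementary cube Q = I_0 x ... x I_(d-1), where coordinate i is encoded by
   (a, e) : int * bool and means the interval [a, a + e] (degenerate iff e = false). *)
Definition cube (d : nat) := {ffun 'I_d -> int * bool}.

Definition cube_dim d (Q : cube d) : nat := #|[set i | (Q i).2]|.

Definition cube_shift d (z : 'I_d -> int) (Q : cube d) : cube d :=
  [ffun i => ((Q i).1 + z i, (Q i).2)].

Definition cube_face d (P Q : cube d) : Prop :=
  forall i, P i = Q i \/
    ((Q i).2 /\ ~~ (P i).2 /\ ((P i).1 = (Q i).1 \/ (P i).1 = (Q i).1 + 1)).

Definition int_dist (a1 b1 a2 b2 : int) : int :=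
  Num.max 0 (Num.max (a2 - b1) (a1 - b2)).
Definition cube_dist d (P Q : cube d) : int :=
  \big[Num.max/0]_(i < d)
    int_dist (P i).1 ((P i).1 + (P i).2%:Z) (Q i).1 ((Q i).1 + (Q i).2%:Z).

Definition in_box d (n : nat) (Q : cube d) : bool :=
  [forall i, (- (n%:Z) <= (Q i).1) && ((Q i).1 + (Q i).2%:Z <= n%:Z)].

(* A cubical filtration {X(t)} (increasing, right-continuous, each X(t) a cubical
   set) is determined by its birth times t_Q in [0, +oo], via
   X(t) = union of the Q with t_Q <= t; the only constraint is that faces are
   born no later than the cube. *)
Definition cubical_filtration (R : realType) d (tb : cube d -> \bar R) : Prop :=
  (forall Q, (0 <= tb Q)%E) /\ (forall P Q, cube_face P Q -> (tb P <= tb Q)%E).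

Definition box_cubes d (n : nat) : seq (cube d) :=
  seq.filter (@in_box d n)
    (map (fun f : {ffun 'I_d -> 'I_(n.*2.+1) * bool} =>
            [ffun i => (((f i).1 : nat)%:Z - n%:Z, (f i).2)] : cube d)
         (enum {ffun 'I_d -> 'I_(n.*2.+1) * bool})).

Definition nbox d n := size (box_cubes d n).
Definition bcube d n (k : 'I_(nbox d n)) : cube d := nth [ffun=> (0, false)] (box_cubes d n) k.

Definition cube_set d (Q : cube d) (i : 'I_d) (a : int) : cube d :=
  [ffun j => if j == i then (a, false) else Q j].

(* coefficient of the facet P in the cubical boundary of Q:
   dQ = sum_{i, e_i = 1} (-1)^{#{j < i | e_j = 1}} (Q_i^+ - Q_i^-) *)
Definition bdry_coef (R : realType) d (Q P : cube d) : R :=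
  \sum_(i < d | (Q i).2)
     (-1) ^+ #|[set j : 'I_d | (j < i)%N && (Q j).2]| *
     ((P == cube_set Q i ((Q i).1 + 1))%:R - (P == cube_set Q i (Q i).1)%:R).

(* boundary matrix, acting on row vectors (chains) *)
Definition bdry_mx (R : realType) d n : 'M[R]_(nbox d n) :=
  \matrix_(k, l) bdry_coef R (bcube k) (bcube l).

Definition chains_mx (R : realType) d n (tb : cube d -> \bar R) (q : nat) (s : R)
  : 'M[R]_(nbox d n) :=
  diag_mx (\row_k ((cube_dim (bcube k) == q) && (tb (bcube k) <= s%:E)%E)%:R).

Definition cycles_mx (R : realType) d n tb q s : 'M[R]_(nbox d n) :=
  (chains_mx n tb q s :&: kermx (bdry_mx R d n))%MS.

Definition bnd_mx (R : realType) d n tb q t : 'M[R]_(nbox d n) :=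
  (chains_mx n tb q.+1 t *m bdry_mx R d n)%R.

(* rank of H_q(X^n(s)) -> H_q(X^n(t)):
   dim Z_q(s) - dim (Z_q(s) cap B_q(t)) = dim (Z_q(s) + B_q(t)) - dim B_q(t) *)
Definition pers_betti (R : realType) d (tb : cube d -> \bar R) (n q : nat) (s t : R)
  : nat :=
  (\rank (cycles_mx n tb q s + bnd_mx n tb q t)%MS - \rank (bnd_mx n tb q t))%N.

Definition in_Delta (R : realType) (p : \bar R * \bar R) : Prop :=
  (0 <= p.1)%E /\ (p.1 < p.2)%E.

(* D (a finite multiset of points of Delta) is the q-th persistence diagram of
   X^n: the counting measure xi = sum_{p in D} delta_p satisfies
   xi([0,s] x (t,+oo]) = beta_q(s,t) for all 0 <= s <= t < oo. *)
Definition is_pers_diagram (R : realType) d (tb : cube d -> \bar R) (n q : nat)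
  (D : seq (\bar R * \bar R)) : Prop :=
  (forall p, p \in D -> in_Delta p) /\
  forall s t : R, 0 <= s -> s <= t ->
    count (fun p => (p.1 <= s%:E)%E && (t%:E < p.2)%E) D = pers_betti tb n q s t.

Definition pers_diagram (R : realType) d (tb : cube d -> \bar R) (n q : nat)
  : seq (\bar R * \bar R) := xget [::] (is_pers_diagram tb n q).

(* Delta is identified with {(x, y) : 0 <= x < y <= 1} via the increasing
   homeomorphism phi : [0, +oo] -> [0, 1], phi(s) = s / (1 + s), phi(+oo) = 1. *)
Definition phiE (R : realType) (x : \bar R) : R :=
  match x with
  | EFin r => r / (1 + r)
  | +oo%E => 1
  | -oo%E => 0
  end.

Definition Delta01 (R : realType) : set (R * R) :=
  [set p | 0 <= p.1 /\ p.1 < p.2 /\ p.2 <= 1].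

Definition toDelta01 (R : realType) (p : \bar R * \bar R) : R * R :=
  (phiE p.1, phiE p.2).

Definition Cc_Delta (R : realType) (f : R * R -> R) : Prop :=
  {within @Delta01 R, continuous f} /\
  exists K : set (R * R), [/\ compact K, K `<=` @Delta01 R &
     forall x, @Delta01 R x -> ~ K x -> f x = 0].

Definition radon_Delta (R : realType) (mu : {measure set (R * R) -> \bar R}) : Prop :=
  mu (~` @Delta01 R) = 0%E /\
  forall K : set (R * R), compact K -> K `<=` @Delta01 R -> (mu K < +oo)%E.

Definition diag_integral (R : realType) (D : seq (\bar R * \bar R)) (f : R * R -> R) : R :=
  \sum_(p <- D) f (toDelta01 p).

Definition box_vol (R : realType) (d n : nat) : R := (n.*2 ^ d)%:R.

Definition random_cubical_filtration (R : realType) (dT : measure_display)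
  (T : measurableType dT) (P : probability T R) d (X : T -> cube d -> \bar R) : Prop :=
  (forall w, cubical_filtration (X w)) /\
  (forall Q, measurable_fun setT (fun w => X w Q)).

Definition cyl_event (R : realType) (T : Type) d (X : T -> cube d -> \bar R)
  (s : seq (cube d)) (B : cube d -> set (\bar R)) : set T :=
  [set w | forall Q, Q \in s -> B Q (X w Q)].

(* stationarity: all finite-dimensional distributions (hence the law) of
   {t_Q}_Q are invariant under translations by Z^d *)
Definition stationary (R : realType) (dT : measure_display)
  (T : measurableType dT) (P : probability T R) d (X : T -> cube d -> \bar R) : Prop :=
  forall (z : 'I_d -> int) (s : seq (cube d)) (B : cube d -> set (\bar R)),
    (forall Q, measurable (B Q)) ->
    P (cyl_event (fun w Q => X w (cube_shift z Q)) s B) = P (cyl_event X s B).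

(* R-dependence: birth-time families of cubes at sup-distance > Rd are
   independent (checked on the generating pi-system of finite cylinders) *)
Definition R_dependent (R : realType) (dT : measure_display)
  (T : measurableType dT) (P : probability T R) d (X : T -> cube d -> \bar R)
  (Rd : nat) : Prop :=
  forall (s1 s2 : seq (cube d)) (B1 B2 : cube d -> set (\bar R)),
    (forall Q1 Q2, Q1 \in s1 -> Q2 \in s2 -> (Rd%:Z < cube_dist Q1 Q2)) ->
    (forall Q, measurable (B1 Q)) -> (forall Q, measurable (B2 Q)) ->
    P (cyl_event X s1 B1 `&` cyl_event X s2 B2) =
    (P (cyl_event X s1 B1) * P (cyl_event X s2 B2))%E.

(* Main.v *)
(** Persistent Betti numbers are almost additive over a grid of separated blocks: cubes
    outside the blocks change the Betti number by at most their number, and chains on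
    separated blocks do not interact.  Up to an error that vanishes with the block size,
    beta_q(s,t)/|Lambda^n| is thus an average over blocks of bounded functions of the pattern
    of births in a block.  Patterns of distinct blocks are pairwise independent by
    R-dependence and identically distributed by stationarity, so an L^2 bound along square
    numbers of blocks, followed by interpolation, makes these averages converge almost surely
    to a constant.

    By inclusion-exclusion, the normalized number of diagram points in each grid box above
    the diagonal converges almost surely.  Functions with compact support in Delta are
    uniformly approximated by grid step functions and the diagram has at most (4n+1)^d
    points, so the integrals of test functions converge to limits that do not depend on the
    sample.  These limits are integrals against a measure: fix one good sample and take the
    limit of its normalized diagrams along an ultrafilter, realized as the image of Lebesgue
    measure by a limit of quantile maps over refining partitions.  The statement on
    expectations follows by dominated convergence. *)
Require Import Defs.
From HB Require Import structures.
From mathcomp Require Import all_boot all_order all_algebra.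
From mathcomp Require Import all_classical all_reals all_analysis.
From mathcomp Require Import measurable_realfun.
From mathcomp Require Import zify ring lra.
Set Implicit Arguments. Unset Strict Implicit. Unset Printing Implicit Defensive.
Import Order.TTheory GRing.Theory Num.Theory.
Import numFieldNormedType.Exports.
Local Open Scope classical_set_scope.
Local Open Scope ring_scope.

(** * Relative ranks and persistent Betti numbers *)

(** A persistent Betti number sees the births only through the inequalities [t_Q <= s] and
    [t_Q <= t]. On a block of fixed size it is therefore a finite combination of indicators of
    cylinder events, and these are the events of which stationarity and R-dependence speak. Square
    numbers of blocks per side serve two ends: the variances become summable, and the ratio of
    consecutive squares still tends to 1, so the passage to all n costs nothing in the limit. For a
    fixed block size m the gaps between blocks do not become negligible. Each m only confines the
    normalized Betti numbers to a band; the bands shrink as m grows, and the limit comes from a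
    Cauchy argument. Betti numbers do not count the points of a box that meets the diagonal. Compact
    support repairs this: extended by zero, a test function is uniformly continuous on the closed
    unit square, and its grid approximation may be 0 on such boxes. As the square is compact, no
    mass escapes along the ultrafilter; what lands off Delta is cut away by restriction. *)

Section RelativeRank.
Variables (F : fieldType) (N : nat).
Implicit Types (Z B : 'M[F]_N).

(* With Z the cycles at time s and B the boundaries at time t, this is the rank of
   H_q(X(s)) -> H_q(X(t)). *)
Definition rel_rank Z B : nat := (\rank (Z + B)%MS - \rank B)%N.

Lemma rel_rankE Z B : (rel_rank Z B + \rank B = \rank (Z + B)%MS)%N.
Proof. by rewrite subnK // mxrankS ?addsmxSr. Qed.

(** Dimension formula for [Z' + B] and [Z + B']: their sum contains [Z' + B'] and their intersection
    contains [Z + B]. *)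
Lemma rank_adds_submodular Z Z' B B' : (Z <= Z')%MS -> (B <= B')%MS ->
  (\rank (Z' + B')%MS + \rank (Z + B)%MS <= \rank (Z' + B)%MS + \rank (Z + B')%MS)%N.
Proof.
move=> ZZ' BB'; rewrite -(mxrank_sum_cap (Z' + B)%MS (Z + B')%MS).
apply: leq_add; apply: mxrankS.
  by rewrite addsmxS ?addsmxSl ?addsmxSr.
by rewrite sub_capmx !addsmxS.
Qed.

(** The ranks of [B] and [B'] cancel in submodularity. For a filtration this says that the rectangle
    ]s, s'] x ]t, t'] receives a nonnegative number of diagram points. *)
Lemma rel_rank_2increasing Z Z' B B' : (Z <= Z')%MS -> (B <= B')%MS ->
  (rel_rank Z' B' + rel_rank Z B <= rel_rank Z' B + rel_rank Z B')%N.
Proof.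
move=> ZZ' BB'; have := rank_adds_submodular ZZ' BB'.
have := rel_rankE Z' B'; have := rel_rankE Z B.
have := rel_rankE Z' B; have := rel_rankE Z B'; lia.
Qed.

Lemma rel_rank_monol Z Z' B : (Z <= Z')%MS -> (rel_rank Z B <= rel_rank Z' B)%N.
Proof. by move=> ZZ'; apply/leq_sub2r/mxrankS/addsmxS. Qed.

(** Submodularity with the zero space as the smaller boundary space. *)
Lemma rel_rank_lipl Z Z' B : (Z <= Z')%MS ->
  (rel_rank Z' B + \rank Z <= rel_rank Z B + \rank Z')%N.
Proof.
move=> ZZ'; have := rank_adds_submodular ZZ' (sub0mx N B).
rewrite !addsmx0_id; have := rel_rankE Z' B; have := rel_rankE Z B; lia.
Qed.

Lemma rel_rank_le Z B : (rel_rank Z B <= \rank Z)%N.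
Proof. by rewrite leq_subLR addnC mxrank_adds_leqif. Qed.

Lemma rel_rank_monor Z B B' : (B <= B')%MS -> (rel_rank Z B' <= rel_rank Z B)%N.
Proof.
move=> BB'; have := rank_adds_submodular (sub0mx N Z) BB'.
rewrite !adds0mx_id; have := rel_rankE Z B'; have := rel_rankE Z B; lia.
Qed.

Lemma rel_rank_lipr Z B B' : (B <= B')%MS ->
  (rel_rank Z B + \rank B <= rel_rank Z B' + \rank B')%N.
Proof. by move=> BB'; rewrite !rel_rankE; apply/mxrankS/addsmxS. Qed.

End RelativeRank.

Section GeneralizedBetti.
Variable F : fieldType.

Definition pred_mx N (a : pred 'I_N) : 'M[F]_N := diag_mx (\row_k (a k)%:R).

Definition gcycles N (D : 'M[F]_N) (a : pred 'I_N) : 'M[F]_N := (pred_mx a :&: kermx D)%MS.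
(* [a] selects the q-cubes present at time s and [b] the (q+1)-cubes present at time t;
   [pers_betti] is convertible to an instance of [gbetti]. *)
Definition gbetti N (D : 'M[F]_N) (a b : pred 'I_N) : nat :=
  rel_rank (gcycles D a) (pred_mx b *m D).

Lemma eq_pred_mx N (a b : pred 'I_N) : a =1 b -> pred_mx a = pred_mx b.
Proof. by move=> ab; congr diag_mx; apply/rowP => k; rewrite !mxE ab. Qed.

Lemma eq_gbetti N (D : 'M[F]_N) a a' b b' : a =1 a' -> b =1 b' ->
  gbetti D a b = gbetti D a' b'.
Proof. by move=> aa' bb'; rewrite /gbetti /gcycles (eq_pred_mx aa') (eq_pred_mx bb'). Qed.

Lemma pred_mxM N (a b : pred 'I_N) : pred_mx a *m pred_mx b = pred_mx (predI a b).
Proof.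
rewrite mulmx_diag; congr diag_mx; apply/rowP => k.
by rewrite !mxE /= -natrM mulnb.
Qed.

Lemma mul_pred_mx N M (a : pred 'I_N) (A : 'M[F]_(N, M)) i j :
  (pred_mx a *m A) i j = (a i)%:R * A i j.
Proof. by rewrite mul_diag_mx !mxE. Qed.

Lemma mul_mx_pred N M (a : pred 'I_N) (A : 'M[F]_(M, N)) i j :
  (A *m pred_mx a) i j = A i j * (a j)%:R.
Proof. by rewrite mul_mx_diag !mxE. Qed.

Lemma pred_mxS N (a b : pred 'I_N) : subpred a b -> (pred_mx a <= pred_mx b)%MS.
Proof.
move=> ab; rewrite -[pred_mx a](_ : pred_mx a *m pred_mx b = _) ?submxMl //.
by rewrite pred_mxM; apply: eq_pred_mx => k /=; case: (boolP (a k)) => // /ab.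
Qed.

Lemma pred_mx_id N M (a : pred 'I_N) (A : 'M[F]_(M, N)) :
  (A <= pred_mx a)%MS -> A *m pred_mx a = A.
Proof.
move=> /submxP[B ->]; rewrite -mulmxA pred_mxM; congr (_ *m _).
by apply: eq_pred_mx => k /=; rewrite andbb.
Qed.

Lemma mxrank_pred_mx N (a : pred 'I_N) : \rank (pred_mx a) = #|a|.
Proof.
suff h (b : pred 'I_N) : (\rank (pred_mx b) <= #|b|)%N.
  apply/eqP; rewrite eqn_leq h /=; pose a' : pred 'I_N := fun k => ~~ a k.
  have : (\rank (1%:M : 'M[F]_N) <= \rank (pred_mx a) + \rank (pred_mx a'))%N.
    rewrite (_ : 1%:M = pred_mx a + pred_mx a'); first exact: mxrank_add.
    apply/matrixP => i j; rewrite !mxE /a' /=.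
    by case: (i == j); case: (a i); rewrite /= ?addr0 ?add0r ?mulr0n.
  have cC : (#|a| + #|a'| = N)%N.
    by rewrite -[RHS]card_ord -(cardC a); congr (_ + _)%N; apply: eq_card.
  rewrite mxrank1; have := h a'; lia.
have -> : pred_mx b = \sum_(k | b k) delta_mx k k.
  apply/matrixP => i j; rewrite summxE !mxE.
  have [bi|bi] := boolP (b i); last first.
    rewrite mul0rn big1 // => k bk; rewrite mxE.
    by case: eqP bi => [->|//]; rewrite bk.
  rewrite (bigD1 i) //= big1 ?addr0 ?mxE ?eqxx //= 1?eq_sym // => k /andP[_ ki].
  by rewrite mxE eq_sym (negPf ki).
rewrite -sum1_card.
elim/big_ind2: _ => [|x1 x2 y1 y2 h1 h2|k _]; first by rewrite mxrank0.
  by apply: leq_trans (mxrank_add _ _) _; apply: leq_add.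
by rewrite mxrank_delta.
Qed.

Lemma gcyclesS N (D : 'M[F]_N) a a' : subpred a a' -> (gcycles D a <= gcycles D a')%MS.
Proof. by move=> aa'; rewrite capmxS // pred_mxS. Qed.

Lemma boundariesS N (D : 'M[F]_N) b b' : subpred b b' ->
  (pred_mx b *m D <= pred_mx b' *m D)%MS.
Proof. by move=> bb'; rewrite submxMr // pred_mxS. Qed.

(** Dimension formula for the cycles on [a'] and the chains on [a]: they meet inside the cycles on
    [a] and span at most the chains on [a']. *)
Lemma rank_gcycles_lip N (D : 'M[F]_N) a a' : subpred a a' ->
  (\rank (gcycles D a') + #|a| <= \rank (gcycles D a) + #|a'|)%N.
Proof.
move=> aa'; rewrite -!mxrank_pred_mx -(mxrank_sum_cap (gcycles D a') (pred_mx a)) addnC.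
rewrite leq_add //; apply: mxrankS.
  rewrite sub_capmx capmxSr (submx_trans (capmxSl _ _)) //.
  exact: capmxSr.
by rewrite addsmx_sub capmxSl pred_mxS.
Qed.

Lemma rank_boundaries_lip N (D : 'M[F]_N) b b' : subpred b b' ->
  (\rank (pred_mx b' *m D) + #|b| <= \rank (pred_mx b *m D) + #|b'|)%N.
Proof.
move=> bb'; pose c := [pred k | b' k && ~~ b k].
have cardb' : #|b'| = (#|b| + #|c|)%N.
  rewrite -(cardID b b'); congr (_ + _)%N; last first.
    by apply: eq_card => k; rewrite !inE andbC.
  apply: eq_card => k; rewrite !inE /in_mem /=.
  by have [/bb' ->|] := boolP (b k); rewrite ?andbT ?andbF.
have : (\rank (pred_mx b' *m D) <= \rank (pred_mx b *m D) + \rank (pred_mx c *m D))%N.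
  rewrite (_ : pred_mx b' *m D = pred_mx b *m D + pred_mx c *m D) ?mxrank_add //.
  rewrite -mulmxDl; congr (_ *m _); apply/matrixP => i j; rewrite !mxE -mulrnDl /=.
  by have [/bb' ->|] := boolP (b i); rewrite /= ?andbT ?andbF ?addr0 ?add0r.
have : (\rank (pred_mx c *m D) <= #|c|)%N by rewrite -mxrank_pred_mx mxrankM_maxl.
rewrite cardb'; lia.
Qed.

(** New (q+1)-cubes only kill classes, so an increase is paid for by the new q-cubes, each of which
    adds at most one dimension of cycles. *)
Lemma gbetti_lip_ge N (D : 'M[F]_N) a a' b b' : subpred a a' -> subpred b b' ->
  (gbetti D a' b' + #|a| <= gbetti D a b + #|a'|)%N.
Proof.
move=> aa' bb'; have := rel_rank_monor (gcycles D a') (boundariesS D bb').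
have := rel_rank_lipl (pred_mx b *m D) (gcyclesS D aa').
have := rank_gcycles_lip D aa'; rewrite /gbetti; lia.
Qed.

(** New q-cubes only add classes, so a decrease is paid for by the new (q+1)-cubes, each of which
    adds at most one dimension of boundaries. *)
Lemma gbetti_lip_le N (D : 'M[F]_N) a a' b b' : subpred a a' -> subpred b b' ->
  (gbetti D a b + #|b| <= gbetti D a' b' + #|b'|)%N.
Proof.
move=> aa' bb'; have := rel_rank_monol (pred_mx b *m D) (gcyclesS D aa').
have := rel_rank_lipr (gcycles D a') (boundariesS D bb').
have := rank_boundaries_lip D bb'; rewrite /gbetti; lia.
Qed.

(** The regions [c1] and [c2] are disjoint and closed under the boundary, so the complex that they
    carry is a direct sum, and cycles and boundaries split accordingly. *)
Lemma gbettiU N (D : 'M[F]_N) (c1 c2 a1 a2 b1 b2 : pred 'I_N) :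
  (forall k, c1 k -> c2 k -> false) ->
  (forall k l, c1 k -> D k l != 0 -> c1 l) ->
  (forall k l, c2 k -> D k l != 0 -> c2 l) ->
  subpred a1 c1 -> subpred a2 c2 -> subpred b1 c1 -> subpred b2 c2 ->
  gbetti D (predU a1 a2) (predU b1 b2) = (gbetti D a1 b1 + gbetti D a2 b2)%N.
Proof.
move=> c12 D1 D2 ac1 ac2 bc1 bc2.
have predDU (x1 x2 : pred 'I_N) : subpred x1 c1 -> subpred x2 c2 ->
    pred_mx (predU x1 x2) = pred_mx x1 + pred_mx x2.
  move=> h1 h2; apply/matrixP => i j; rewrite !mxE -mulrnDl -natrD /=; congr (_%:R *+ _).
  have [/h1 /c12 h|_] := boolP (x1 i) => //.
  by have [/h2 /h|] := boolP (x2 i).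
have P0 : pred_mx c1 *m pred_mx c2 = 0.
  apply/matrixP => i j; rewrite mul_pred_mx !mxE.
  have [/c12|_] := boolP (c1 i); last by rewrite mul0r.
  by case: (c2 i) => [/(_ isT)|_]; rewrite ?mul0rn ?mulr0.
have DP (c b : pred 'I_N) : (forall k l, c k -> D k l != 0 -> c l) -> subpred b c ->
    pred_mx b *m D = pred_mx b *m D *m pred_mx c.
  move=> cD bc; apply/matrixP => i j; rewrite mul_mx_pred !mul_pred_mx.
  have [/bc /cD h|_] := boolP (b i); last by rewrite !mul0r.
  have [->|/h ->] := eqVneq (D i j) 0; first by rewrite mulr0 mul0r.
  by rewrite mulr1.
have P00 : pred_mx c2 *m pred_mx c1 = 0.
  by rewrite pred_mxM -P0 pred_mxM; apply: eq_pred_mx => k /=; rewrite andbC.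
have B12 : (pred_mx (predU b1 b2) *m D :=: pred_mx b1 *m D + pred_mx b2 *m D)%MS.
  apply/eqmxP; rewrite predDU // mulmxDl addmx_sub_adds //=.
  set B1 := pred_mx b1 *m D; set B2 := pred_mx b2 *m D.
  (* Cutting the rows of the sum down to [c1] gives back [B1], so its row space lies in that of the
     sum; likewise for [B2]. *)
  have B1P : B1 = pred_mx c1 *m (B1 + B2).
    apply/matrixP => i j; rewrite mul_pred_mx [X in _ * X]mxE /B1 /B2 !mul_pred_mx.
    have [/c12 h | c1i] := boolP (c1 i).
      have [/bc2 /h //|_] := boolP (b2 i); by rewrite mul1r mul0r addr0.
    by have [/bc1|_] := boolP (b1 i); rewrite ?(negPf c1i) // !mul0r.
  have B2P : B2 = pred_mx c2 *m (B1 + B2).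
    apply/matrixP => i j; rewrite mul_pred_mx [X in _ * X]mxE /B1 /B2 !mul_pred_mx.
    have [h | c2i] := boolP (c2 i).
      have [/bc1 /c12 /(_ h) //|_] := boolP (b1 i); by rewrite mul1r mul0r add0r.
    by have [/bc2|_] := boolP (b2 i); rewrite ?(negPf c2i) // !mul0r.
  by rewrite addsmx_sub {1}B1P submxMl /= {1}B2P submxMl.
have Z12 : (gcycles D (predU a1 a2) :=: gcycles D a1 + gcycles D a2)%MS.
  apply/eqmxP/andP; split; last first.
    rewrite addsmx_sub; apply/andP; split; apply: gcyclesS => k /= -> //.
    by rewrite orbT.
  (* Split a cycle into its parts on [a1] and [a2]: their boundaries live in [c1] and [c2] and add
     up to zero, so each of them is zero. *)
  set Z := gcycles _ _.
  have ZD : Z *m D = 0 by apply/sub_kermxP; exact: capmxSr.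
  have Zs : Z = Z *m pred_mx a1 + Z *m pred_mx a2.
    rewrite -mulmxDr -predDU //; apply/esym/pred_mx_id; exact: capmxSl.
  have PD : Z *m pred_mx a1 *m D + Z *m pred_mx a2 *m D = 0 by rewrite -mulmxDl -Zs.
  have PD1 : Z *m pred_mx a1 *m D *m pred_mx c2 = 0.
    by rewrite -!mulmxA [X in _ *m X]mulmxA (DP c1) // -[X in _ *m X]mulmxA P0 !mulmx0.
  have PD2 : Z *m pred_mx a2 *m D *m pred_mx c2 = 0.
    by rewrite -[RHS](mul0mx _ (pred_mx c2)) -PD mulmxDl PD1 add0r.
  have PD2' : Z *m pred_mx a2 *m D = 0.
    by rewrite -mulmxA (DP c2) // !mulmxA PD2.
  have PD1' : Z *m pred_mx a1 *m D = 0 by move: PD; rewrite PD2' addr0.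
  rewrite Zs addmx_sub_adds // sub_capmx submxMl; apply/sub_kermxP => //.
(* Row spaces supported on disjoint sets of columns meet only in zero, so their dimensions add. *)
have rk (W1 W2 : 'M[F]_N) : W1 *m pred_mx c1 = W1 -> W2 *m pred_mx c2 = W2 ->
    \rank (W1 + W2)%MS = (\rank W1 + \rank W2)%N.
  move=> h1 h2; rewrite -mxrank_sum_cap.
  suff -> : (W1 :&: W2)%MS = 0 by rewrite mxrank0 addn0.
  apply/eqP; rewrite -submx0.
  have /submxP[A1 e1] := capmxSl W1 W2; have /submxP[A2 e2] := capmxSr W1 W2.
  have f1 : (W1 :&: W2)%MS = (W1 :&: W2)%MS *m pred_mx c1.
    by rewrite [in RHS]e1 -mulmxA h1 -e1.
  have f2 : (W1 :&: W2)%MS = (W1 :&: W2)%MS *m pred_mx c2.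
    by rewrite [in RHS]e2 -mulmxA h2 -e2.
  by rewrite f1 f2 -mulmxA P00 mulmx0 sub0mx.
have ZP (a c : pred 'I_N) : subpred a c -> gcycles D a *m pred_mx c = gcycles D a.
  by move=> ac; apply/pred_mx_id/(submx_trans (capmxSl _ _))/pred_mxS.
have addP (U W : 'M[F]_N) c : U *m pred_mx c = U -> W *m pred_mx c = W ->
    (U + W)%MS *m pred_mx c = (U + W)%MS.
  move=> hU hW; apply: pred_mx_id; by rewrite addsmx_sub -{1}hU submxMl -{1}hW submxMl.
rewrite /gbetti /rel_rank.
have -> : \rank (gcycles D (predU a1 a2) + pred_mx (predU b1 b2) *m D)%MS =
    \rank ((gcycles D a1 + pred_mx b1 *m D) + (gcycles D a2 + pred_mx b2 *m D))%MS.
  apply/eqmx_rank; apply/eqmxP.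
  apply: (eqmx_trans (adds_eqmx Z12 B12)); rewrite -!addsmxA.
  by rewrite (addsmxA (gcycles D a2)) (addsmxC (gcycles D a2)) -!addsmxA.
rewrite (rk (gcycles D a1 + pred_mx b1 *m D)%MS (gcycles D a2 + pred_mx b2 *m D)%MS); last 2 first.
- by apply: addP; [exact: ZP|exact/esym/DP].
- by apply: addP; [exact: ZP|exact/esym/DP].
rewrite B12 (rk (pred_mx b1 *m D) (pred_mx b2 *m D)); last 2 first.
- exact/esym/DP.
- exact/esym/DP.
have := rel_rankE (gcycles D a1) (pred_mx b1 *m D).
have := rel_rankE (gcycles D a2) (pred_mx b2 *m D).
rewrite /rel_rank; lia.
Qed.

(** [e] places the small complex inside the large one as a part closed under the boundary. Its
    matrix [E] intertwines the two boundaries and is row free, so right multiplication by [E]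
    carries cycles and boundaries over with their ranks. *)
Lemma gbetti_embed N M (DN : 'M[F]_N) (DM : 'M[F]_M) (e : 'I_M -> 'I_N)
    (aM bM : pred 'I_M) (aN bN : pred 'I_N) : injective e ->
  (forall k l, DN (e k) (e l) = DM k l) ->
  (forall k l, DN (e k) l != 0 -> exists k', l = e k') ->
  (forall l, aN l -> exists k, l = e k) -> (forall l, bN l -> exists k, l = e k) ->
  (forall k, aN (e k) = aM k) -> (forall k, bN (e k) = bM k) ->
  gbetti DN aN bN = gbetti DM aM bM.
Proof.
move=> einj De Dim aim bim ae be.
pose E : 'M[F]_(M, N) := \matrix_(k, l) (l == e k)%:R.
have EA p (A : 'M[F]_(N, p)) i j : (E *m A) i j = A (e i) j.
  rewrite mxE (bigD1 (e i)) //= mxE eqxx mul1r big1 ?addr0 // => k /negPf ke.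
  by rewrite mxE ke mul0r.
have Efree : row_free E.
  apply/row_freeP; exists E^T; apply/matrixP => i j.
  by rewrite EA !mxE (inj_eq einj).
have AE p (A : 'M[F]_(p, M)) i k : (A *m E) i (e k) = A i k.
  rewrite mxE (bigD1 k) //= mxE eqxx mulr1 big1 ?addr0 // => k' /negPf ke.
  by rewrite mxE (inj_eq einj) eq_sym ke mulr0.
have AE0 p (A : 'M[F]_(p, M)) i l : ~ (exists k, l = e k) -> (A *m E) i l = 0.
  move=> h; rewrite mxE big1 // => k _; rewrite mxE; case: eqP => [le|]; last by rewrite mulr0.
  by case: h; exists k.
have ED : E *m DN = DM *m E.
  apply/matrixP => k l; rewrite EA.
  have [|/negbNE/eqP Dkl] := boolP (DN (e k) l != 0).
    by move=> /Dim[k' ->]; rewrite AE De.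
  rewrite Dkl; case: (pickP (fun k' => l == e k')) => [k' /eqP lk|h].
    by rewrite lk AE -De -lk Dkl.
  by rewrite AE0 // => -[k' /eqP]; rewrite h.
have pE (xN : pred 'I_N) (xM : pred 'I_M) : (forall l, xN l -> exists k, l = e k) ->
    (forall k, xN (e k) = xM k) -> E *m pred_mx xN = pred_mx xM *m E /\
      pred_mx xN = E^T *m E *m pred_mx xN.
  move=> xim xe; split; apply/matrixP => k l.
    by rewrite EA mul_pred_mx !mxE xe mulr_natr eq_sym.
  rewrite mul_mx_pred; have [xl|xl] := boolP (xN l).
    have [k' lk] := xim _ xl; rewrite lk AE !mxE mulr1 -lk.
    by case: eqP => [->|]; rewrite ?xl.
  by rewrite mulr0 !mxE; case: eqP => [->|//]; rewrite (negPf xl).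
have pS (xN : pred 'I_N) (xM : pred 'I_M) : (forall l, xN l -> exists k, l = e k) -> (forall k, xN (e k) = xM k) ->
    (pred_mx xN :=: pred_mx xM *m E)%MS.
  move=> h1 h2; have [p1 p2] := pE _ _ h1 h2; apply/eqmxP.
  by rewrite {1}p2 -mulmxA p1 submxMl -p1 submxMl.
have BE : (pred_mx bN *m DN :=: (pred_mx bM *m DM) *m E)%MS.
  by rewrite -mulmxA -ED mulmxA; apply: eqmxMr; apply: pS.
have ZE : (gcycles DN aN :=: gcycles DM aM *m E)%MS.
  apply/eqmxP/andP; split; last first.
    rewrite sub_capmx (pS _ _ aim ae) submxMr ?capmxSl //; apply/sub_kermxP.
    rewrite -mulmxA ED mulmxA (_ : _ *m DM = 0) ?mul0mx //.
    by apply/sub_kermxP; rewrite capmxSr.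
  have : (gcycles DN aN <= pred_mx aM *m E)%MS by rewrite -(pS _ _ aim ae) capmxSl.
  case/submxP => Y; rewrite mulmxA => eY; rewrite {1}eY; apply: submxMr.
  rewrite sub_capmx submxMl; apply/sub_kermxP.
  apply: (row_free_inj Efree); rewrite mul0mx -mulmxA -ED mulmxA -eY.
  by apply/sub_kermxP; rewrite capmxSr.
rewrite /gbetti /rel_rank BE mxrankMfree //; congr (_ - _)%N.
by rewrite (adds_eqmx ZE BE) -(mxrankMfree (_ + _)%MS Efree) addsmxMr.
Qed.

End GeneralizedBetti.

(** * Existence and size of persistence diagrams *)

Section Thresholds.
Variable R : realType.
Implicit Types V : seq R.

(* Index 0 is a sentinel below every birth time, where all Betti numbers vanish. *)
Definition threshold V i : R := nth 0 (-1 :: sort <=%R (undup V)) i.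

Lemma sorted_threshold V : (forall v, v \in V -> 0 <= v) ->
  sorted <%R (-1 :: sort <=%R (undup V)).
Proof.
move=> V0; rewrite lt_sorted_uniq_le /= sort_uniq undup_uniq andbT; apply/andP; split.
  by rewrite mem_sort mem_undup; apply/negP => /V0; rewrite ler0N1.
rewrite path_min_sorted ?sort_le_sorted //; apply/allP => v.
by rewrite mem_sort mem_undup => /V0; apply: le_trans; rewrite lerN10.
Qed.

Lemma threshold_lt V i j : (forall v, v \in V -> 0 <= v) ->
  (j <= size (undup V))%N -> (i < j)%N -> threshold V i < threshold V j.
Proof.
move=> /sorted_threshold sV jV ij; apply: (sorted_ltn_nth lt_trans) => //.
- by rewrite inE /= size_sort; apply: leq_ltn_trans (ltnW ij) _.
- by rewrite inE /= size_sort.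
Qed.

Lemma threshold_le V i j : (forall v, v \in V -> 0 <= v) ->
  (j <= size (undup V))%N -> (i <= j)%N -> threshold V i <= threshold V j.
Proof.
move=> V0 jV; rewrite leq_eqVlt => /orP[/eqP->//|ij].
exact/ltW/threshold_lt.
Qed.

Lemma threshold_ge0 V i : (forall v, v \in V -> 0 <= v) ->
  (0 < i)%N -> (i <= size (undup V))%N -> 0 <= threshold V i.
Proof.
move=> V0; case: i => // i _ iV; apply: V0; rewrite -mem_undup -(mem_sort <=%R).
by apply: mem_nth; rewrite size_sort.
Qed.

Lemma thresholdP V v : v \in V ->
  exists2 i, (0 < i <= size (undup V))%N & v = threshold V i.
Proof.
rewrite -mem_undup -(mem_sort <=%R) => vV.
exists (index v (sort <=%R (undup V))).+1; last by rewrite /threshold /= nth_index.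
by rewrite /= -(size_sort <=%R) index_mem.
Qed.

(** The sentinel -1 makes index 0 available for times before the first birth, so every nonnegative
    time has an index. *)
Lemma threshold_index V s : (forall v, v \in V -> 0 <= v) -> 0 <= s ->
  exists2 c, (c <= size (undup V))%N &
    forall i, (i <= size (undup V))%N -> (threshold V i <= s) = (i <= c)%N.
Proof.
move=> V0 s0.
have ex0 : exists i, (i <= size (undup V))%N && (threshold V i <= s).
  by exists 0%N; rewrite leq0n /threshold /= (le_trans _ s0) // lerN10.
have bd i : (i <= size (undup V))%N && (threshold V i <= s) -> (i <= size (undup V))%N.
  by case/andP.
case: (ex_maxnP ex0 bd) => c /andP[cV cs] cmax; exists c => // i iV.
apply/idP/idP => [h|ic]; first by rewrite cmax ?iV.
by apply: le_trans cs; apply: threshold_le.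
Qed.

End Thresholds.

Lemma count_addE (T : eqType) (a b c e : pred T) (s : seq T) :
  (forall x, x \in s -> (a x + b x = c x + e x)%N) ->
  (count a s + count b s = count c s + count e s)%N.
Proof.
elim: s => //= x s IH h.
have := h x (mem_head _ _); have /IH : forall y, y \in s -> (a y + b y = c y + e y)%N.
  by move=> y ys; apply: h; rewrite inE ys orbT.
lia.
Qed.

Section Diagrams.
Variables (R : realType) (d n q : nat) (tb : cube d -> \bar R).

Lemma cycles_mxS s s' : s <= s' -> (cycles_mx n tb q s <= cycles_mx n tb q s')%MS.
Proof.
move=> ss'; apply: gcyclesS => k /= /andP[-> /=] /le_trans; apply.
by rewrite lee_fin.
Qed.

Lemma bnd_mxS t t' : t <= t' -> (bnd_mx n tb q t <= bnd_mx n tb q t')%MS.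
Proof.
move=> tt'; apply: boundariesS => k /= /andP[-> /=] /le_trans; apply.
by rewrite lee_fin.
Qed.

Lemma eq_pers_betti s s' t t' :
  (forall k : 'I_(nbox d n), (tb (bcube k) <= s%:E)%E = (tb (bcube k) <= s'%:E)%E) ->
  (forall k : 'I_(nbox d n), (tb (bcube k) <= t%:E)%E = (tb (bcube k) <= t'%:E)%E) ->
  pers_betti tb n q s t = pers_betti tb n q s' t'.
Proof. by move=> hs ht; apply: eq_gbetti => k /=; rewrite ?hs ?ht. Qed.

Lemma pers_betti_2increasing s s' t t' : s <= s' -> t <= t' ->
  (pers_betti tb n q s' t' + pers_betti tb n q s t <=
   pers_betti tb n q s' t + pers_betti tb n q s t')%N.
Proof. by move=> ss' tt'; apply: rel_rank_2increasing; [exact: cycles_mxS|exact: bnd_mxS]. Qed.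

Lemma pers_betti_le s s' t : s <= s' -> (pers_betti tb n q s t <= pers_betti tb n q s' t)%N.
Proof. by move=> ss'; apply: rel_rank_monol; exact: cycles_mxS. Qed.

Hypothesis tb0 : forall Q, (0 <= tb Q)%E.

Lemma pers_betti_neg s t : s < 0 -> pers_betti tb n q s t = 0%N.
Proof.
move=> s0; apply/eqP; rewrite -leqn0; apply: (leq_trans (rel_rank_le _ _)).
have -> : cycles_mx n tb q s = gcycles (bdry_mx R d n) pred0.
  rewrite /cycles_mx /gcycles; congr (_ :&: _)%MS; apply: eq_pred_mx => k /=.
  apply/negbTE; rewrite negb_and; apply/orP; right.
  by rewrite -ltNge (lt_le_trans _ (tb0 _)) // lte_fin.
by apply: (leq_trans (mxrankS (capmxSl _ _))); rewrite mxrank_pred_mx card0.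
Qed.

Definition finite_births : seq R :=
  [seq fine (tb Q) | Q <- box_cubes d n & (tb Q \is a fin_num)].

Lemma finite_births_ge0 v : v \in finite_births -> 0 <= v.
Proof. by case/mapP => Q _ ->; apply: fine_ge0. Qed.

Lemma pers_betti_threshold s : 0 <= s -> exists2 c, (c <= size (undup finite_births))%N &
  (forall i, (i <= size (undup finite_births))%N ->
    (threshold finite_births i <= s) = (i <= c)%N) /\
  forall k : 'I_(nbox d n),
    (tb (bcube k) <= s%:E)%E = (tb (bcube k) <= (threshold finite_births c)%:E)%E.
Proof.
move=> s0; have [c cV ch] := threshold_index finite_births_ge0 s0.
exists c => //; split=> // k.
case E : (tb (bcube k)) => [v||].
- have : v \in finite_births.
    apply/mapP; exists (bcube k); last by rewrite E.
    by rewrite mem_filter E /= mem_nth.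
  case/thresholdP => i /andP[i0 iV] ->; rewrite !lee_fin ch //.
  apply/idP/idP => [ic|]; first exact: threshold_le finite_births_ge0 _ _.
  by rewrite leNgt; apply: contraR; rewrite -ltnNge => /(threshold_lt finite_births_ge0 iV).
- by rewrite !leye_eq.
- by have := tb0 (bcube k); rewrite E.
Qed.

(** All points have finite births and deaths among the thresholds, or death +oo for the classes
    still alive at the last threshold [w r]. The counting identity is a double telescoping sum, over
    deaths and over births. *)
Lemma exists_pers_diagram : exists D, is_pers_diagram tb n q D.
Proof.
pose V := finite_births; pose r := size (undup V); pose w := threshold V.
pose b i j := pers_betti tb n q (w i) (w j).
(* The multiplicity of (w i, w j) by inclusion-exclusion; the truncated subtraction is exact
   by [pers_betti_2increasing]. *)
pose m i j := ((i < j) * (b i j.-1 + b i.-1 j - (b i.-1 j.-1 + b i j)))%N.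
pose D : seq (\bar R * \bar R) :=
  flatten [seq flatten [seq nseq (m i j) ((w i)%:E, (w j)%:E) | j <- index_iota 1 r.+1] ++
            nseq (b i r - b i.-1 r) ((w i)%:E, +oo%E) | i <- index_iota 1 r.+1].
have wle i j : (i <= j)%N -> (j <= r)%N -> w i <= w j.
  by move=> ij jr; apply: threshold_le finite_births_ge0 _ _.
exists D; split.
  move=> p /flattenP[S /mapP[i + ->]]; rewrite mem_index_iota => /andP[i1 ir].
  have wi0 : (0 <= (w i)%:E)%E by rewrite lee_fin; apply: threshold_ge0 finite_births_ge0 _ _.
  rewrite mem_cat => /orP[/flattenP[S' /mapP[j + ->]]|].
    rewrite mem_index_iota => /andP[j1 jr]; rewrite mem_nseq => /andP[+ /eqP ->].
    rewrite /m muln_gt0 => /andP[+ _]; case: (ltnP i j) => // ij _.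
    by split=> //=; rewrite lte_fin; apply: threshold_lt finite_births_ge0 _ _.
  by rewrite mem_nseq => /andP[_ /eqP ->]; split=> //=; rewrite ltry.
move=> s t s0 st.
have [cs csV [css csb]] := pers_betti_threshold s0.
have [ct ctV [ctt ctb]] := pers_betti_threshold (le_trans s0 st).
have cst : (cs <= ct)%N.
  by rewrite -ctt // (le_trans _ st) // css.
rewrite (eq_pers_betti csb ctb) -/w -/(b cs ct).
rewrite count_flatten sumnE big_map big_map.
have -> : (\sum_(i <- index_iota 1 r.+1) count (fun p => (p.1 <= s%:E)%E && (t%:E < p.2)%E)
    (flatten [seq nseq (m i j) ((w i)%:E, (w j)%:E) | j <- index_iota 1 r.+1] ++
     nseq (b i r - b i.-1 r) ((w i)%:E, +oo%E)) =
   \sum_(1 <= i < r.+1) (i <= cs) * (\sum_(1 <= j < r.+1) (ct < j) * m i j + (b i r - b i.-1 r)))%N.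
  apply: eq_big_nat => i /andP[i1 ir]; rewrite count_cat count_flatten sumnE !big_map.
  rewrite mulnDr big_distrr /= count_nseq /= lee_fin css // ltry andbT; congr (_ + _)%N.
  apply: eq_big_nat => j /andP[j1 jr]; rewrite count_nseq /= lee_fin css // lte_fin.
  by rewrite ltNge ctt // -ltnNge mulnA mulnb.
(* Telescoping in the death index. The last threshold is generalized to [k] for the induction:
   whatever is alive at [k] counts as never dying. *)
have inner i k : (0 < i <= cs)%N -> (ct <= k <= r)%N ->
    (\sum_(1 <= j < k.+1) (ct < j) * m i j + (b i k - b i.-1 k) = b i ct - b i.-1 ct)%N.
  move=> /andP[i0 ics] /andP[ctk]; elim: k ctk => [|k IH].
    by rewrite leqn0 => /eqP -> _; rewrite big_geq.
  have [ctk _ kr|ctk ctk1 kr] := leqP ct k; last first.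
    have -> : ct = k.+1 by apply/eqP; rewrite eqn_leq ctk1 ctk.
    rewrite big_nat big1 // => j /andP[_]; rewrite ltnS leqNgt => /negPf ->.
    by rewrite mul0n.
  rewrite big_nat_recr //= -(IH ctk (ltnW kr)) ltnS ctk mul1n /m /=.
  have -> /= : (i < k.+1)%N by rewrite ltnS (leq_trans ics) // (leq_trans cst).
  have iV : (i <= r)%N by rewrite (leq_trans ics).
  have := pers_betti_2increasing (wle _ _ (leq_pred i) iV) (wle _ _ (leqnSn k) kr).
  rewrite -/(b i k.+1) -/(b i.-1 k) -/(b i k) -/(b i.-1 k.+1).
  have := pers_betti_le (w k) (wle _ _ (leq_pred i) iV).
  have := pers_betti_le (w k.+1) (wle _ _ (leq_pred i) iV).
  rewrite -/(b i k.+1) -/(b i.-1 k) -/(b i k) -/(b i.-1 k.+1); lia.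
(* Telescoping in the birth index; the lower end is the sentinel, where Betti numbers vanish. *)
have outer k : (\sum_(1 <= i < k.+1) (i <= cs) * (b i ct - b i.-1 ct) = b (minn k cs) ct)%N.
  elim: k => [|k IH].
    by rewrite big_geq // min0n /b pers_betti_neg // /w /threshold /= ltrN10.
  rewrite big_nat_recr //= IH; have [kcs|kcs] := leqP k.+1 cs.
    rewrite (minn_idPl (ltnW kcs)) mul1n subnKC //.
    by apply: pers_betti_le; apply: wle; rewrite // (leq_trans kcs).
  by rewrite mul0n addn0; congr b; apply: minn_idPr.
rewrite -[RHS](_ : b (minn r cs) ct = _); last by rewrite (minn_idPr csV).
rewrite -outer; apply: eq_big_nat => i /andP[i1 ir].
have [ics|//] := leqP i cs; rewrite inner ?i1 ?ics //.
by rewrite ctV /= leqnn.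
Qed.

Lemma pers_diagramP : is_pers_diagram tb n q (pers_diagram tb n q).
Proof. by apply: xgetPex; exact: exists_pers_diagram. Qed.

(** By induction along the births that occur in [D], the number of points born so far is at most the
    dimension of the space of cycles. At the last birth this bounds the size of [D] by the number of
    cubes. *)
Lemma size_is_pers_diagram D : is_pers_diagram tb n q D -> (size D <= nbox d n)%N.
Proof.
move=> [DD Dcount]; pose V : seq R := [seq fine p.1 | p <- D].
have finb p : p \in D -> p.1 \is a fin_num.
  move=> /DD[p0 p1]; rewrite ge0_fin_numE //; apply: lt_le_trans p1 _; exact: leey.
have V0 v : v \in V -> 0 <= v by case/mapP => p /DD[p0 _] ->; exact: fine_ge0.
pose r := size (undup V); pose w := threshold V.
have cnt s t : s <= t -> 0 <= t ->
    count (fun p : \bar R * \bar R => (p.1 <= s%:E)%E && (t%:E < p.2)%E) D = pers_betti tb n q s t.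
  move=> st t0; have [s0|s0] := leP 0 s; first exact: Dcount.
  rewrite pers_betti_neg //; apply/eqP; rewrite -leqn0 leqNgt -has_count -all_predC.
  apply/allP => p /DD[p0 _] /=; rewrite negb_and -ltNge (lt_le_trans _ p0) ?lte_fin //.
have key i : (i <= r)%N ->
    (count (fun p : \bar R * \bar R => (p.1 <= (w i)%:E)%E) D <= \rank (cycles_mx n tb q (w i)))%N.
  elim: i => [_|i IH ir].
    apply: (@leq_trans 0%N) => //; rewrite leqNgt -has_count; apply: contraT => /negPn/hasP[p /DD[p0 _]] /(le_trans p0).
    by rewrite /w /threshold /= lee_fin ler0N1.
  have := IH (ltnW ir); set b := w i.+1.
  have wib : w i < b by apply: threshold_lt.
  have b0 : 0 <= b by apply: threshold_ge0.
  have := rel_rank_lipl (bnd_mx n tb q b) (cycles_mxS (ltW wib)).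
  (* A point born after [w i] and no later than [b] is born at [b] itself, hence dies after [b]. So
     beta(b, b) - beta(w i, b) counts these points, and it is at most the growth of the space of
     cycles. *)
  have := @count_addE _ (fun p => (p.1 <= b%:E)%E)
     (fun p => (p.1 <= (w i)%:E)%E && (b%:E < p.2)%E)
     (fun p => (p.1 <= (w i)%:E)%E) (fun p => (p.1 <= b%:E)%E && (b%:E < p.2)%E) D.
  rewrite (cnt (w i) b) ?(ltW wib) // (cnt b b) // => /(_ _)/wrap[].
    move=> p pD; have [p0 p1] := DD p pD; have pf := finb p pD.
    have : fine p.1 \in V by apply/mapP; exists p.
    case/thresholdP => j /andP[j0 jr] pj.
    have pE : p.1 = (w j)%:E by rewrite -(fineK pf) pj.
    rewrite pE !lee_fin; have [ji|ij] := leqP j i.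
      have wji : w j <= w i by apply: threshold_le => //; exact: ltnW.
      by rewrite wji (le_trans wji (ltW wib)) addnC.
    have -> /= : (w j <= w i) = false by apply/negbTE; rewrite -ltNge; apply: threshold_lt.
    have [jb|//] := leP (w j) b.
    have jE : w j = b by apply/eqP; rewrite eq_le jb /=; apply: threshold_le.
    by rewrite -jE -pE p1.
  have arith (x y z u v1 v2 : nat) :
    (x + u = y + v1 -> v1 + z <= u + v2 -> y <= z -> x <= v2)%N by lia.
  exact: arith.
have -> : size D = count (fun p : \bar R * \bar R => (p.1 <= (w r)%:E)%E) D.
  rewrite -[LHS]count_predT; apply: eq_in_count => p pD /=; apply/esym.
  have : fine p.1 \in V by apply/mapP; exists p.
  case/thresholdP => j /andP[j0 jr] pj.
  by rewrite -(fineK (finb p pD)) pj lee_fin; apply: threshold_le.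
by apply: leq_trans (key r (leqnn _)) _; apply: rank_leq_row.
Qed.

End Diagrams.

(** * Block decomposition *)

Section Cubes.
Variable d : nat.
Implicit Types (Q P : cube d) (z : 'I_d -> int).

Lemma in_boxP n Q : reflect (forall i, - n%:Z <= (Q i).1 /\ (Q i).1 + (Q i).2%:Z <= n%:Z) (in_box n Q).
Proof.
apply: (iffP forallP) => h i; first by have /andP := h i.
by apply/andP; have := h i.
Qed.

Lemma mem_box_cubes n Q : (Q \in box_cubes d n) = in_box n Q.
Proof.
rewrite mem_filter; have [Qn|//] := boolP (in_box n Q).
have /in_boxP h := Qn; apply/mapP.
exists [ffun i => (inord `|(Q i).1 + n%:Z|, (Q i).2)]; first by rewrite mem_enum.
apply/ffunP => i; rewrite !ffunE; have [h1 h2] := h i.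
rewrite /= inordK; first by case: (Q i) h1 h2 => a b /= h1 h2; congr (_, _); lia.
by move: h1 h2; case: (Q i).2; lia.
Qed.

Lemma uniq_box_cubes n : uniq (box_cubes d n).
Proof.
rewrite filter_uniq // map_inj_uniq ?enum_uniq // => f g /ffunP fg.
apply/ffunP => i; have := fg i; rewrite !ffunE.
case: (f i) (g i) => [a b] [a' b'] [/= aa' ->]; congr (_, _); apply: val_inj => /=; lia.
Qed.

(** In each coordinate, [-n, n] contains 2n + 1 integer points and 2n unit intervals. *)
Lemma nboxE n : nbox d n = ((4 * n).+1 ^ d)%N.
Proof.
pose A := [pred p : 'I_(n.*2.+1) * bool | p.1 + p.2 <= n.*2]%N.
have -> : (4 * n).+1 = #|A|.
  have -> : #|A| = (\sum_(p : 'I_(n.*2.+1) * bool) (p.1 + p.2 <= n.*2))%N.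
    by rewrite -sum1_card [LHS]big_mkcond; apply: eq_bigr => p _; rewrite inE; case: (_ <= _)%N.
  rewrite -(pair_bigA_idem _ (fun (a : 'I_(n.*2.+1)) (b : bool) => (a + b <= n.*2 : nat)%N)) //=.
  transitivity (\sum_(a < n.*2.+1) ((a + true <= n.*2) + (a + false <= n.*2)))%N; last first.
    by apply: eq_bigr => a _; rewrite big_bool.
  rewrite big_split /= [X in (_ + X)%N](eq_bigr (fun=> 1%N)); last first.
    by move=> a _; rewrite addn0 -ltnS ltn_ord.
  rewrite sum1_card card_ord big_ord_recr /= addn1 ltnn addn0.
  rewrite (eq_bigr (fun=> 1%N)); last by move=> a _; rewrite addn1 ltn_ord.
  rewrite sum1_card card_ord; lia.
rewrite /nbox /box_cubes size_filter count_map -sum1_count big_enum_cond /= sum1_card.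
rewrite -[X in (_ ^ X)%N](card_ord d) -card_ffun_on.
apply: eq_card => f; rewrite !unfold_in /=; apply: eq_forallb => i.
rewrite !ffunE /=; case: (f i) => a b /=.
apply/andP/idP; rewrite unfold_in /=; case: b => /=; lia.
Qed.

Lemma bcube_inj n : injective (@bcube d n).
Proof.
move=> k l /eqP; rewrite /bcube nth_uniq ?uniq_box_cubes //.
by move=> /eqP/val_inj.
Qed.

Lemma bcube_in_box n (k : 'I_(nbox d n)) : in_box n (bcube k).
Proof. by rewrite -mem_box_cubes mem_nth. Qed.

Lemma bcube_surj n Q : in_box n Q -> {k : 'I_(nbox d n) | bcube k = Q}.
Proof.
rewrite -mem_box_cubes => Qn.
by exists (Ordinal (etrans (index_mem Q (box_cubes d n)) Qn)); rewrite /bcube nth_index.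
Qed.

Lemma cube_shiftK z : cancel (@cube_shift d z) (cube_shift (fun i => - z i)).
Proof. by move=> Q; apply/ffunP => i; rewrite !ffunE /= addrK; case: (Q i). Qed.

Lemma cube_shiftVK z : cancel (cube_shift (fun i => - z i)) (@cube_shift d z).
Proof. by move=> Q; apply/ffunP => i; rewrite !ffunE /= addrNK; case: (Q i). Qed.

Lemma cube_dim_shift z Q : cube_dim (cube_shift z Q) = cube_dim Q.
Proof.
rewrite /cube_dim (_ : [set i | (cube_shift z Q i).2] = [set i | (Q i).2]) //.
by apply/seteqP; split=> i /=; rewrite ffunE.
Qed.

Lemma cube_set_shift z Q i a :
  cube_set (cube_shift z Q) i (a + z i) = cube_shift z (cube_set Q i a).
Proof. by apply/ffunP => j; rewrite !ffunE; case: eqP => [->|]. Qed.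

Lemma bdry_coef_shift (R : realType) z Q P :
  bdry_coef R (cube_shift z Q) (cube_shift z P) = bdry_coef R Q P.
Proof.
apply: eq_big => [i|i _]; first by rewrite ffunE.
congr (_ ^+ _ * (_%:R - _%:R)).
- rewrite (_ : [set j : 'I_d | (j < i)%N && (cube_shift z Q j).2] =
              [set j : 'I_d | (j < i)%N && (Q j).2]) //.
  by apply/seteqP; split=> j /=; rewrite ffunE.
- by rewrite ffunE /= addrAC cube_set_shift (inj_eq (can_inj (cube_shiftK z))).
- by rewrite ffunE /= cube_set_shift (inj_eq (can_inj (cube_shiftK z))).
Qed.

Lemma bdry_coef_neq0 (R : realType) Q P : bdry_coef R Q P != 0 ->
  exists2 i, (Q i).2 & P = cube_set Q i ((Q i).1 + 1) \/ P = cube_set Q i (Q i).1.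
Proof.
move=> nz; case: (pickP [pred i | (Q i).2 &&
    ((P == cube_set Q i ((Q i).1 + 1)) || (P == cube_set Q i (Q i).1))]) => [i|none].
  by case/andP => Qi /orP[]/eqP Pi; exists i => //; [left|right].
case/eqP: nz; apply: big1 => i Qi; have := none i; rewrite /= Qi /=.
by move/negbT; rewrite negb_or => /andP[/negPf-> /negPf->]; rewrite subrr mulr0.
Qed.

Definition in_block z m Q := in_box m (cube_shift (fun i => - z i) Q).

Lemma in_blockP z m Q :
  reflect (forall i, z i - m%:Z <= (Q i).1 /\ (Q i).1 + (Q i).2%:Z <= z i + m%:Z) (in_block z m Q).
Proof. by apply: (iffP (in_boxP m _)) => h i; have := h i; rewrite ffunE /=; lia. Qed.

Lemma in_block_shift z m Q : in_block z m (cube_shift z Q) = in_box m Q.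
Proof. by rewrite /in_block cube_shiftK. Qed.

(** Facets stay in the block; this is the closure under the boundary required by [gbettiU] and
    [gbetti_embed]. *)
Lemma in_block_bdry (R : realType) z m Q P :
  in_block z m Q -> bdry_coef R Q P != 0 -> in_block z m P.
Proof.
move=> /in_blockP Qz /bdry_coef_neq0[i Qi2 PE]; apply/in_blockP => j.
have := Qz j; have [->|ji] := eqVneq j i; last by case: PE => ->; rewrite ffunE (negPf ji).
by case: PE => ->; rewrite !ffunE eqxx /= Qi2; lia.
Qed.

Lemma in_block_in_box z m n Q :
  (forall i, m%:Z - n%:Z <= z i <= n%:Z - m%:Z) -> in_block z m Q -> in_box n Q.
Proof.
move=> zn /in_blockP h; apply/in_boxP => i.
by have := h i; have /andP := zn i; lia.
Qed.

Lemma cube_dist_block (r m : nat) z z' Q Q' i :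
  ((m.*2 + r)%:Z < `|z i - z' i|) ->
  in_block z m Q -> in_block z' m Q' -> r%:Z < cube_dist Q Q'.
Proof.
move=> zz /in_blockP/(_ i)[h1 h2] /in_blockP/(_ i)[h3 h4].
rewrite /cube_dist; apply: lt_le_trans (le_bigmax_cond _ _ (_ : predT i)); last by [].
rewrite /int_dist !lt_max; move: (nat_of_bool (Q i).2) (nat_of_bool (Q' i).2) h1 h2 h3 h4 => e e'.
by move=> h1 h2 h3 h4; apply/orP; right; apply/orP; case: (leP (z i) (z' i)) => ?; [left|right]; lia.
Qed.

Lemma in_block_disjoint (r m : nat) z z' Q i :
  ((m.*2 + r)%:Z < `|z i - z' i|) ->
  in_block z m Q -> in_block z' m Q -> false.
Proof.
by move=> zz /in_blockP/(_ i)[h1 h2] /in_blockP/(_ i)[h3 h4]; move: h1 h2 h3 h4; case: (Q i).2; lia.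
Qed.

(* Centres of the K^d blocks of half-side m <= h that tile [-hK, hK]^d with period 2h. *)
Definition grid_center (h K : nat) (j : {ffun 'I_d -> 'I_K}) (i : 'I_d) : int :=
  (2 * h * j i)%:Z + h%:Z - (h * K)%:Z.

Lemma grid_center_bound h K j i m n : (m <= h)%N -> (h * K <= n)%N ->
  m%:Z - n%:Z <= @grid_center h K j i <= n%:Z - m%:Z.
Proof.
move=> mh hKn; rewrite /grid_center.
have jK : (2 * h * j i + h + h <= 2 * (h * K))%N.
  have := ltn_ord (j i); rewrite -(leq_pmul2l (isT : 0 < 2)%N) => jK.
  have := leq_mul2l h (2 * (j i).+1) (2 * K); rewrite jK orbT; lia.
by apply/andP; split; lia.
Qed.

(** In a coordinate where the indices differ, the centres are at least 2h apart, and 2h > 2(m +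
    r). *)
Lemma grid_center_far h K (j j' : {ffun 'I_d -> 'I_K}) m r : (m + r < h)%N -> j != j' ->
  exists i, (m.*2 + r)%:Z < `|grid_center h j i - grid_center h j' i|.
Proof.
move=> mrh jj'; have [i ji] : exists i, j i != j' i.
  apply/existsP; apply: contraNT jj'; rewrite negb_exists => /forallP e.
  by apply/eqP/ffunP => i; apply/eqP/negbNE; exact: e.
exists i; rewrite /grid_center.
have jn : (j i : nat) <> j' i by move=> /val_inj/eqP; rewrite (negPf ji).
have [lt|lt|//] := ltngtP (j i) (j' i).
  have := leq_mul2l (2 * h) (j i).+1 (j' i); rewrite lt orbT; lia.
have := leq_mul2l (2 * h) (j' i).+1 (j i); rewrite lt orbT; lia.
Qed.

End Cubes.

Section BlockDecomposition.
Variables (R : realType) (d q : nat) (tb : cube d -> \bar R) (s t : R).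

Let bpred n (p : nat) (u : R) : pred 'I_(nbox d n) :=
  fun k => (cube_dim (bcube k) == p) && (tb (bcube k) <= u%:E)%E.

(** Cutting down to the block about [z] amounts to observing the translated births in the centred
    box, which is the form to which stationarity applies. *)
Lemma gbetti_block z m n : (forall i, m%:Z - n%:Z <= z i <= n%:Z - m%:Z) ->
  gbetti (bdry_mx R d n) (fun k => bpred q s k && in_block z m (bcube k))
     (fun k => bpred q.+1 t k && in_block z m (bcube k)) =
  pers_betti (fun Q => tb (cube_shift z Q)) m q s t.
Proof.
move=> zn.
have ein (k : 'I_(nbox d m)) : in_box n (cube_shift z (bcube k)).
  by apply: (in_block_in_box zn); rewrite in_block_shift bcube_in_box.
pose e k := sval (bcube_surj (ein k)).
have eE k : bcube (e k) = cube_shift z (bcube k) by exact: svalP (bcube_surj (ein k)).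
have imE l : in_block z m (bcube l) -> exists k, l = e k.
  move=> /bcube_surj[k kE]; exists k; apply: bcube_inj.
  by rewrite eE kE cube_shiftVK.
apply: (gbetti_embed (e := e)).
- by move=> k l kl; apply: bcube_inj; apply: (can_inj (cube_shiftK z)); rewrite -!eE kl.
- by move=> k l; rewrite !mxE !eE bdry_coef_shift.
- move=> k l; rewrite mxE => /(in_block_bdry (z := z) (m := m)) h; apply/imE/h.
  by rewrite eE in_block_shift bcube_in_box.
- by move=> l /andP[_ /imE].
- by move=> l /andP[_ /imE].
- by move=> k; rewrite /bpred eE in_block_shift bcube_in_box andbT cube_dim_shift.
- by move=> k; rewrite /bpred eE in_block_shift bcube_in_box andbT cube_dim_shift.
Qed.

Lemma gbetti_blocks (I : eqType) (z : I -> 'I_d -> int) (r m n : nat) (l : seq I) : uniq l ->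
  (forall j, forall i, m%:Z - n%:Z <= z j i <= n%:Z - m%:Z) ->
  (forall j j', j != j' -> exists i, (m.*2 + r)%:Z < `|z j i - z j' i|) ->
  gbetti (bdry_mx R d n) (fun k => bpred q s k && has (fun j => in_block (z j) m (bcube k)) l)
     (fun k => bpred q.+1 t k && has (fun j => in_block (z j) m (bcube k)) l) =
  (\sum_(j <- l) pers_betti (fun Q => tb (cube_shift (z j) Q)) m q s t)%N.
Proof.
move=> lu zn zz; elim: l lu => [_|j l IH /= /andP[jl lu]].
  rewrite big_nil; apply/eqP; rewrite -leqn0 /gbetti; apply: leq_trans (rel_rank_le _ _) _.
  apply: leq_trans (mxrankS (capmxSl _ _)) _; rewrite mxrank_pred_mx.
  by rewrite eq_card0 // => k; rewrite /in_mem /= andbF.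
rewrite big_cons -IH // -(gbetti_block (zn j)).
rewrite -(gbettiU (c1 := fun k => in_block (z j) m (bcube k))
    (c2 := fun k => has (fun j => in_block (z j) m (bcube k)) l)).
- by apply: eq_gbetti => k /=; rewrite andb_orr.
- move=> k jk /hasP[j' j'l j'k]; have [|i zi] := zz j j'; last exact: in_block_disjoint zi jk j'k.
  by apply: contraNneq jl => ->.
- by move=> k l' kj; rewrite mxE; apply: in_block_bdry.
- move=> k l' /hasP[j' j'l kj]; rewrite mxE => nz; apply/hasP; exists j' => //.
  exact: in_block_bdry kj nz.
- by move=> k /andP[].
- by move=> k /andP[].
- by move=> k /andP[].
- by move=> k /andP[].
Qed.

(** Keep only the cubes inside blocks. At most (4n+1)^d - K^d (4m+1)^d cubes are discarded, and by
    the Lipschitz bounds the Betti number moves by no more than that. The bounds are stated as sums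
    because subtraction on [nat] truncates. *)
Lemma pers_betti_grid (r m h K n : nat) : (m + r < h)%N -> (h * K <= n)%N ->
  let S := (\sum_(j : {ffun 'I_d -> 'I_K})
     pers_betti (fun Q => tb (cube_shift (grid_center h j) Q)) m q s t)%N in
  (pers_betti tb n q s t + K ^ d * (4 * m).+1 ^ d <= S + (4 * n).+1 ^ d)%N /\
  (S + K ^ d * (4 * m).+1 ^ d <= pers_betti tb n q s t + (4 * n).+1 ^ d)%N.
Proof.
move=> mrh hKn S.
have mh : (m <= h)%N by lia.
have zn j i := @grid_center_bound d h K j i m n mh hKn.
have zz j j' := @grid_center_far d h K j j' m r mrh.
pose l := index_enum {ffun 'I_d -> 'I_K}.
have lu : uniq l by exact: index_enum_uniq.
pose U : pred 'I_(nbox d n) := fun k => has (fun j => in_block (grid_center h j) m (bcube k)) l.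
have SE := gbetti_blocks lu zn zz.
(* Pairs of a block and a cube of the centred box inject into the cubes lying in some block. *)
have cardU : (K ^ d * (4 * m).+1 ^ d <= #|U|)%N.
  have -> : (K ^ d * (4 * m).+1 ^ d)%N = #|{: {ffun 'I_d -> 'I_K} * 'I_(nbox d m)}|.
    by rewrite card_prod card_ffun !card_ord nboxE.
  have ein (p : {ffun 'I_d -> 'I_K} * 'I_(nbox d m)) :
      in_box n (cube_shift (grid_center h p.1) (bcube p.2)).
    by apply: (in_block_in_box (zn p.1)); rewrite in_block_shift bcube_in_box.
  pose e p := sval (bcube_surj (ein p)).
  have eE p : bcube (e p) = cube_shift (grid_center h p.1) (bcube p.2).
    exact: svalP (bcube_surj (ein p)).
  rewrite -(card_codom (f := e)).
    apply: subset_leq_card; apply/fintype.subsetP => _ /codomP[p ->]; rewrite unfold_in.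
    apply/hasP; exists p.1; first exact: mem_index_enum.
    by rewrite eE in_block_shift bcube_in_box.
  move=> p p' pp'; have h1 : in_block (grid_center h p.1) m (bcube (e p)).
    by rewrite eE in_block_shift bcube_in_box.
  have h2 : in_block (grid_center h p'.1) m (bcube (e p)).
    by rewrite pp' eE in_block_shift bcube_in_box.
  have p1 : p.1 = p'.1.
    by apply/eqP/negbNE/negP => /zz[i zi]; have := in_block_disjoint zi h1 h2.
  have p2 : p.2 = p'.2.
    apply: bcube_inj; apply: (can_inj (cube_shiftK (grid_center h p.1))).
    by rewrite -eE pp' eE p1.
  by case: p p' p1 p2 {pp' h1 h2} => ? ? [? ?] /= -> ->.
have cardA (a : pred 'I_(nbox d n)) :
    (#|a| + K ^ d * (4 * m).+1 ^ d <= #|[pred k | a k && U k]| + (4 * n).+1 ^ d)%N.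
  have e1 : (#|U| + #|[predC U]| = (4 * n).+1 ^ d)%N.
    by rewrite cardC -nboxE; exact: card_ord.
  have e2 := cardID U a.
  have e3 : (#|[predI a & U]| <= #|[pred k | a k && U k]|)%N.
    by apply: subset_leq_card; apply/fintype.subsetP => k; rewrite !inE.
  have e4 : (#|[predD a & U]| <= #|[predC U]|)%N.
    by apply: subset_leq_card; apply/fintype.subsetP => k; rewrite !inE => /andP[].
  have arith (x1 x2 x3 x4 x5 x6 x7 x8 : nat) : (x1 + x2 = x3 -> x4 + x5 = x6 -> x4 <= x7 ->
    x5 <= x2 -> x8 <= x1 -> x6 + x8 <= x7 + x3)%N by lia.
  exact: arith e1 e2 e3 e4 cardU.
have aU (a : pred 'I_(nbox d n)) : subpred (fun k => a k && U k) a by move=> k /andP[].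
have h1 := gbetti_lip_ge (bdry_mx R d n) (aU (bpred q s)) (aU (bpred q.+1 t)).
have h2 := gbetti_lip_le (bdry_mx R d n) (aU (bpred q s)) (aU (bpred q.+1 t)).
have c1 := cardA (bpred q s); have c2 := cardA (bpred q.+1 t).
rewrite SE in h1 h2; split.
  have arith (x1 x2 x3 x4 x5 x6 : nat) : (x1 + x2 <= x3 + x4 -> x4 + x5 <= x2 + x6 ->
    x1 + x5 <= x3 + x6)%N by lia.
  exact: arith h1 c1.
have arith (x1 x2 x3 x4 x5 x6 : nat) : (x1 + x2 <= x3 + x4 -> x4 + x5 <= x2 + x6 ->
  x1 + x5 <= x3 + x6)%N by lia.
exact: arith h2 c2.
Qed.

End BlockDecomposition.

(** * Strong law for pairwise independent events *)

Section PairwiseLLN.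
Context (R : realType) (dT : measure_display) (T : measurableType dT) (P : probability T R).

Lemma sum_inv_sqr_le2 n : \sum_(k < n) (k.+1%:R ^+ 2)^-1 <= 2 :> R.
Proof.
(* The sharper bound is inductive: 1/(n+1)^2 <= 2/(n+1) - 2/(n+2). *)
suff : \sum_(k < n) (k.+1%:R ^+ 2)^-1 <= 2 - 2 / n.+1%:R :> R.
  by move=> /le_trans; apply; rewrite gerBl divr_ge0.
elim: n => [|n IH]; first by rewrite big_ord0 divr1 subrr.
rewrite big_ord_recr /=; apply: (le_trans (lerD IH (lexx _))).
rewrite -subr_ge0.
have n1 : n.+1%:R != 0 :> R by rewrite pnatr_eq0.
have n2 : n.+2%:R != 0 :> R by rewrite pnatr_eq0.
rewrite (_ : _ - _ = n%:R / (n.+1%:R ^+ 2 * n.+2%:R)).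
  by rewrite divr_ge0 // mulr_ge0 // exprn_ge0.
have e1 : n.+1%:R = n%:R + 1 :> R by rewrite -natr1.
have e2 : n.+2%:R = n%:R + 2 :> R by rewrite -addn2 natrD.
by move: n1 n2; rewrite e1 e2 => n1 n2; field; rewrite n1 n2.
Qed.

Definition empirical_mean (J : finType) (E : J -> set T) (w : T) : R :=
  (\sum_j \1_(E j) w) / #|J|%:R.

Lemma measurable_empirical_mean (J : finType) (E : J -> set T) :
  (forall j, measurable (E j)) -> measurable_fun setT (empirical_mean E).
Proof.
move=> mE; apply: measurable_funM => //.
by apply: measurable_sum => j; exact: measurable_indic.
Qed.

(** Expanding the square over pairs, the off-diagonal ones contribute p^2 each by pairwise
    independence, and the integral comes out as p(1 - p)/#|J|. *)
Lemma variance_empirical_mean (J : finType) (E : J -> set T) (p : R) :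
  (0 < #|J|)%N -> (forall j, measurable (E j)) ->
  (forall j, P (E j) = p%:E) ->
  (forall j j', j != j' -> P (E j `&` E j') = (p * p)%:E) ->
  (\int[P]_w ((empirical_mean E w - p) ^+ 2)%:E <= (#|J|%:R^-1)%:E)%E.
Proof.
move=> J0 mE PE PEE; set N : R := #|J|%:R.
have N0 : 0 < N by rewrite ltr0n.
have p01 : 0 <= p <= 1.
  have /card_gt0P[j _] := J0.
  by rewrite -!lee_fin -(PE j) measure_ge0 probability_le1.
have mV : measurable_fun setT (fun w => (empirical_mean E w - p) ^+ 2).
  by apply: measurable_funX; apply: measurable_funB => //; exact: measurable_empirical_mean.
pose S2 (w : T) : \bar R := (\sum_(x : J * J) ((N^-1 ^+ 2)%:E * (\1_(E x.1 `&` E x.2) w)%:E))%E.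
pose S1 (w : T) : \bar R := (\sum_j ((2 * p / N)%:E * (\1_(E j) w)%:E))%E.
have mI (A : set T) : measurable A -> measurable_fun setT (fun w => (\1_A w)%:E : \bar R).
  by move=> mA; apply/measurable_EFinP; exact: measurable_indic.
have int1 : (\int[P]_w S1 w = (2 * p * p)%:E)%E.
  rewrite ge0_integral_sum //; last 2 first.
  - by move=> j; apply: measurable_funeM; exact: mI.
  - by move=> j w _; rewrite -EFinM lee_fin mulr_ge0 // divr_ge0 ?(ltW N0) //; lra.
  rewrite (eq_bigr (fun=> (2 * p / N * p)%:E)); last first.
    move=> j _; rewrite ge0_integralZl_EFin //; last 2 first.
    - exact: mI.
    - by rewrite divr_ge0 ?(ltW N0) //; lra.
    rewrite integral_indic // setIT.
    by rewrite [RHS]EFinM; congr (_ * _)%E; exact: PE.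
  rewrite sumEFin sumr_const; congr _%:E; rewrite -mulr_natr -/N.
  by field; rewrite gt_eqF.
have int2 : (\int[P]_w S2 w = (N^-1 * p + (1 - N^-1) * p ^+ 2)%:E)%E.
  rewrite ge0_integral_sum //; last 2 first.
  - by move=> j; apply: measurable_funeM; apply: mI; exact: measurableI.
  - by move=> j w _; rewrite -EFinM lee_fin mulr_ge0 // exprn_ge0 // invr_ge0 (ltW N0).
  rewrite (eq_bigr (fun x : J * J => ((N^-1 ^+ 2) * (if x.1 == x.2 then p else p * p))%:E)); last first.
    move=> [j j'] _ /=; rewrite ge0_integralZl_EFin //; last 2 first.
    - by apply: mI; exact: measurableI.
    - by rewrite exprn_ge0 // invr_ge0 (ltW N0).
    rewrite integral_indic ?setIT //; last exact: measurableI.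
    rewrite [RHS]EFinM; congr (_ * _)%E.
    by case: eqVneq => [->|/PEE //]; rewrite setIid; exact: PE.
  rewrite sumEFin; congr _%:E; rewrite -mulr_sumr.
  rewrite -(pair_bigA _ (fun j j' : J => if j == j' then p else p * p)) /=.
  rewrite (eq_bigr (fun=> p + (N - 1) * (p * p))); last first.
    move=> j _; rewrite (bigD1 j) //= eqxx; congr (_ + _).
    rewrite (eq_bigr (fun=> p * p)); last by move=> j' /negPf; rewrite eq_sym => ->.
    rewrite sumr_const -[LHS]mulr_natl; congr (_ * _ : R).
    rewrite (eq_card (B := [predC pred1 j])) // (_ : #|_| = #|J|.-1); last first.
      by rewrite -(cardC1 j).
    by rewrite -subn1 natrB.
  rewrite sumr_const -[X in _ * X]mulr_natl -/N.
  by field; rewrite gt_eqF.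
(* Both sides are sums of nonnegative terms, so additivity of nonnegative integrals suffices. *)
have E12 w : (((empirical_mean E w - p) ^+ 2)%:E + S1 w = S2 w + (p ^+ 2)%:E)%E.
  rewrite /S1 /S2.
  under eq_bigr do rewrite -EFinM.
  under [in RHS]eq_bigr do rewrite -EFinM.
  rewrite !sumEFin -!EFinD -!mulr_sumr; congr _%:E.
  have -> : \sum_(x : J * J) \1_(E x.1 `&` E x.2) w = (\sum_j \1_(E j) w) ^+ 2 :> R.
    rewrite expr2 big_distrlr /= pair_bigA /=; apply: eq_bigr => x _.
    by rewrite indicI.
  by rewrite /empirical_mean -/N; field; rewrite gt_eqF.
have : (\int[P]_w (((empirical_mean E w - p) ^+ 2)%:E + S1 w) =
        \int[P]_w (S2 w + (p ^+ 2)%:E))%E by apply: eq_integral => w _.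
rewrite ge0_integralD //=; last 4 first.
- by move=> w _; rewrite lee_fin sqr_ge0.
- exact/measurable_EFinP.
- move=> w _; apply: sume_ge0 => j _; rewrite -EFinM lee_fin mulr_ge0 // divr_ge0 ?(ltW N0) //; lra.
- by apply: emeasurable_sum => j; apply: measurable_funeM; exact: mI.
rewrite ge0_integralD //=; last 3 first.
- by move=> w _; apply: sume_ge0 => j _; rewrite -EFinM lee_fin mulr_ge0 // exprn_ge0 // invr_ge0 (ltW N0).
- by apply: emeasurable_sum => j; apply: measurable_funeM; apply: mI; exact: measurableI.
- by move=> w _; rewrite lee_fin sqr_ge0.
rewrite int1 int2 integral_cst // [X in (_ * X)%E](@probability_setT _ _ _ P) mule1.
case: (\int[P]_w _)%E => [v||]; rewrite -?EFinD //= => -[h].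
rewrite lee_fin -subr_ge0.
have -> : N^-1 - v = N^-1 * (1 - p + p ^+ 2).
  apply/eqP; rewrite subr_eq; apply/eqP.
  apply: (@addIr _ (2 * p * p)); rewrite -addrA h; ring.
by rewrite mulr_ge0 ?invr_ge0 ?(ltW N0) //; nra.
Qed.

(** At least (k+1)^2 events at stage k make the variances summable. The series of squared deviations
    then has finite integral, so it converges almost surely and its terms tend to 0. Independence is
    used inside each stage only, since the families of different stages may overlap. *)
Lemma pairwise_lln (J : nat -> finType) (E : forall k, J k -> set T) (p : R) :
  (forall k, (k.+1 ^ 2 <= #|J k|)%N) -> (forall k j, measurable (E k j)) ->
  (forall k j, P (E k j) = p%:E) ->
  (forall k j j', j != j' -> P (E k j `&` E k j') = (p * p)%:E) ->
  {ae P, forall w, (fun k => empirical_mean (@E k) w) @ \oo --> p}.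
Proof.
move=> J2 mE PE PEE.
pose V k w : \bar R := ((empirical_mean (@E k) w - p) ^+ 2)%:E.
have J0 k : (0 < #|J k|)%N by apply: leq_trans (J2 k).
have V0 k w : (0 <= V k w)%E by rewrite lee_fin sqr_ge0.
have mV k : measurable_fun setT (V k).
  apply/measurable_EFinP; apply: measurable_funX; apply: measurable_funB => //.
  exact: measurable_empirical_mean.
have intV : (\int[P]_w (\sum_(k <oo) V k w) <= 2%:E)%E.
  rewrite integral_nneseries //.
  apply: lime_le; first by apply: is_cvg_nneseries => k _ _; exact: integral_ge0.
  apply: nearW => n; apply: (@le_trans _ _ (\sum_(0 <= k < n) ((k.+1%:R ^+ 2)^-1)%:E)%E).
    apply: lee_sum => k _; apply: le_trans (variance_empirical_mean (J0 k) (mE k) (PE k) (PEE k)) _.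
    rewrite lee_fin lef_pV2 ?posrE ?ltr0n ?exprn_gt0 ?ltr0n //.
    by rewrite -natrX ler_nat.
  by rewrite sumEFin lee_fin big_mkord sum_inv_sqr_le2.
have iV : P.-integrable setT (fun w => (\sum_(k <oo) V k w)%E).
  apply/integrableP; split.
    by apply: ge0_emeasurable_sum => // k; exact: mV.
  rewrite (eq_integral (fun w => (\sum_(k <oo) V k w)%E)); last first.
    by move=> w _; rewrite gee0_abs // nneseries_ge0.
  by apply: le_lt_trans intV _; rewrite ltry.
apply: filterS (integrable_ae measurableT iV) => w /(_ I) Vfin.
have /cvg_series_cvg_0 : cvgn (series (fun k => (empirical_mean (@E k) w - p) ^+ 2)).
  apply: nnseries_is_cvg => [k|]; first exact: sqr_ge0.
  by rewrite ltey_eq Vfin.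
move=> /(@cvg_comp _ _ _ _ (@Num.sqrt R)) h.
have : (fun k => `|empirical_mean (@E k) w - p|) @ \oo --> (0 : R).
  rewrite -[X in _ --> X]sqrtr0 (_ : (fun k => _) = (@Num.sqrt R) \o (fun k => (empirical_mean (@E k) w - p) ^+ 2)).
    by apply: h; exact: sqrt_continuous.
  by apply/funext => k /=; rewrite sqrtr_sqr.
by move=> /norm_cvg0P/subr_cvg0.
Qed.

End PairwiseLLN.

Lemma cvgr_sum (R : realType) (T I : Type) (F : set_system T) (FF : Filter F)
    (r : seq I) (f : I -> T -> R) (a : I -> R) :
  (forall i, f i @ F --> a i) ->
  (fun x => \sum_(i <- r) f i x) @ F --> \sum_(i <- r) a i.
Proof.
by move=> fa; apply: (cvg_big (op := +%R)) => [|i _]; [exact: add_continuous|exact: fa].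
Qed.

Lemma ae_forall_countable (R : realType) (dT : measure_display) (T : measurableType dT)
    (P : {measure set T -> \bar R}) (C : countType) (A : C -> T -> Prop) :
  (forall c, {ae P, forall w, A c w}) -> {ae P, forall w, forall c, A c w}.
Proof.
move=> h; have := @ae_foralln _ _ _ P
  (fun n w => if unpickle n is Some c then A c w else True).
have /[swap] /[apply] : forall n, \forall w \ae P, if unpickle n is Some c then A c w else True.
  by move=> n; case: (unpickle n) => [c|]; [exact: h|exact: aeW].
by apply: filterS => w h' c; have := h' (pickle c); rewrite pickleK.
Qed.

Section Interpolation.
Variable R : realType.
Implicit Types (h m d : nat).

Lemma sqr_bracket h n : (0 < h)%N -> (h <= n)%N ->
  exists k, (h * k.+1 ^ 2 <= n < h * k.+2 ^ 2)%N.
Proof.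
move=> h0 hn.
have ex : exists k, (h * k.+1 ^ 2 <= n)%N by exists 0%N; rewrite muln1.
have bd k : (h * k.+1 ^ 2 <= n)%N -> (k <= n)%N.
  move=> kn; apply: leq_trans kn; rewrite expnS expn1 -{1}[k]mul1n leq_mul //.
  by rewrite -{1}[k]mul1n leq_mul.
case: (ex_maxnP ex bd) => k kn kmax; exists k; rewrite kn /= ltnNge.
by apply/negP => /kmax; rewrite ltnn.
Qed.

(* The last k with h (k+1)^2 <= n (junk value 0 if n < h). *)
Definition sqr_index h n : nat :=
  if pselect ((0 < h)%N /\ (h <= n)%N) is left p then sval (cid (sqr_bracket p.1 p.2)) else 0%N.

Lemma sqr_indexP h n : (0 < h)%N -> (h <= n)%N ->
  (h * (sqr_index h n).+1 ^ 2 <= n < h * (sqr_index h n).+2 ^ 2)%N.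
Proof.
move=> h0 hn; rewrite /sqr_index; by case: pselect => [p|[]//]; case: cid.
Qed.

Lemma sqr_index_cvg h : (0 < h)%N -> sqr_index h @ \oo --> \oo.
Proof.
move=> h0; apply/cvgnyPge => A; exists (h * A.+2 ^ 2)%N => //= n hn.
have hhn : (h <= n)%N by apply: leq_trans hn; rewrite leq_pmulr.
have /andP[_ n1] := sqr_indexP h0 hhn.
rewrite leqNgt; apply/negP => kA.
have : (h * (sqr_index h n).+2 ^ 2 <= h * A.+2 ^ 2)%N by rewrite leq_mul2l leq_exp2r // !ltnS (ltnW kA) orbT.
by move=> /(leq_trans n1); rewrite ltnNge hn.
Qed.

Lemma sqr_index_ratio_cvg h : (0 < h)%N ->
  (fun n => (h * (sqr_index h n).+1 ^ 2)%:R / n%:R : R) @ \oo --> (1 : R).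
Proof.
move=> h0.
(* With k the index of n, the bound n < h (k+2)^2 puts the ratio above ((k+1)/(k+2))^2, and
   [1 - harmonic k.+1] equals (k+1)/(k+2). *)
apply: (@squeeze_cvgr _ _ _ _ (fun n => (1 - harmonic (sqr_index h n).+1) ^+ 2) (fun=> 1)); last 2 first.
- rewrite -[X in _ --> X](_ : (1 - 0) ^+ 2 = 1 :> R); last by rewrite subr0 expr1n.
  have hc : (fun n => harmonic (sqr_index h n).+1 : R) @ \oo --> (0 : R).
    apply: (@cvg_comp _ _ _ (sqr_index h) (fun k => harmonic k.+1 : R)).
      exact: sqr_index_cvg.
    by rewrite (cvg_shiftS (harmonic : R^nat)); exact: cvg_harmonic.
  rewrite expr2; under eq_fun do rewrite expr2.
  by apply: cvgM; apply: cvgB => //; exact: cvg_cst.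
- exact: cvg_cst.
exists h => //= n hn.
have /andP[n1 n2] := sqr_indexP h0 hn.
have n0 : 0 < n%:R :> R by rewrite ltr0n (leq_trans h0).
apply/andP; split; last by rewrite ler_pdivrMr // mul1r ler_nat.
rewrite ler_pdivlMr //; set k := sqr_index h n in n1 n2 *.
have -> : 1 - harmonic k.+1 = k.+1%:R / k.+2%:R :> R.
  rewrite /harmonic /= -(@natr1 _ k.+1); have := ler0n R k.+1.
  by move: (k.+1%:R) => a a0; field; rewrite gt_eqF //; lra.
rewrite expr_div_n mulrAC ler_pdivrMr ?exprn_gt0 ?ltr0n //.
rewrite natrM natrX [h%:R * _]mulrC -[X in _ <= X]mulrA.
rewrite ler_pM2l ?exprn_gt0 ?ltr0n //.
by rewrite -natrX -natrM ler_nat ltnW.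
Qed.

(** [a] is the limit mean per block and (2h)^d the volume per block. The error is the limit of the
    number of cubes outside the blocks per unit volume: all cubes have density 2^d, those in blocks
    ((4m+1)/(2h))^d. *)
Lemma interpolate_cvg d h m (u S : nat -> nat) (a : R) : (0 < h)%N ->
  (forall k n, (h * k.+1 ^ 2 <= n)%N ->
    (u n + (k.+1 ^ 2) ^ d * (4 * m).+1 ^ d <= S k + (4 * n).+1 ^ d)%N /\
    (S k + (k.+1 ^ 2) ^ d * (4 * m).+1 ^ d <= u n + (4 * n).+1 ^ d)%N) ->
  (fun k => (S k)%:R / ((k.+1 ^ 2) ^ d)%:R) @ \oo --> a ->
  forall e, 0 < e -> \forall n \near \oo,
    `|(u n)%:R / box_vol R d n - a / (2 * h%:R) ^+ d| <=
      2 ^+ d - ((4 * m).+1%:R / (2 * h%:R)) ^+ d + e.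
Proof.
move=> h0 uS Sa e e0.
pose K n := ((sqr_index h n).+1 ^ 2)%N.
pose rho n : R := (h * K n)%:R / n%:R.
have rho1 : rho @ \oo --> (1 : R) by exact: sqr_index_ratio_cvg.
have hR : 0 < h%:R :> R by rewrite ltr0n.
(* [An] is the block sum over the volume of the box, and [Bn] the number of discarded cubes over
   that volume. Both are written through [rho], whose limit 1 gives theirs. *)
pose An n : R := (S (sqr_index h n))%:R / (K n ^ d)%:R * (rho n / (2 * h%:R)) ^+ d.
pose Bn n : R := (2 + 2^-1 * n%:R^-1) ^+ d - ((4 * m).+1%:R * (rho n / (2 * h%:R))) ^+ d.
have cX (f : nat -> R) (l : R) : f @ \oo --> l -> (fun n => f n ^+ d) @ \oo --> l ^+ d.
  move=> fl; apply: (@cvg_comp _ _ _ f (fun x => x ^+ d)); first exact: fl.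
  exact: exprn_continuous.
have cA : An @ \oo --> a / (2 * h%:R) ^+ d.
  apply: cvgM; last first.
    rewrite -exprVn; apply: cX; rewrite -[X in _ --> X]mul1r; apply: cvgM => //; exact: cvg_cst.
  exact: (@cvg_comp _ _ _ (sqr_index h) (fun k => (S k)%:R / ((k.+1 ^ 2) ^ d)%:R) _ _ _ (sqr_index_cvg h0)).
have cB : Bn @ \oo --> (2 ^+ d - ((4 * m).+1%:R / (2 * h%:R)) ^+ d : R).
  apply: cvgB; apply: cX.
    rewrite -[X in _ --> X]addr0; apply: cvgD; first exact: cvg_cst.
    rewrite -[X in _ --> X](mulr0 2^-1); apply: cvgM; first exact: cvg_cst.
    by apply/gtr0_cvgV0; [exists 1%N => // n /= n0; rewrite ltr0n|exact: cvgr_idn].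
  apply: cvgM; first exact: cvg_cst.
  by rewrite -[X in _ --> X]mul1r; apply: cvgM => //; exact: cvg_cst.
have key n : (h <= n)%N -> `|(u n)%:R / box_vol R d n - An n| <= Bn n.
  move=> hn; have /andP[n1 n2] := sqr_indexP h0 hn.
  have [h1 h2] := uS _ _ n1.
  have n0 : 0 < n%:R :> R by rewrite ltr0n (leq_trans h0).
  have v0 : 0 < box_vol R d n.
    by rewrite /box_vol ltr0n expn_gt0 double_gt0 (leq_trans h0).
  have rE : rho n / (2 * h%:R) = (K n)%:R / (2 * n%:R).
    by rewrite /rho natrM; field; rewrite !gt_eqF.
  have vE : box_vol R d n = (2 * n%:R) ^+ d by rewrite /box_vol natrX -mul2n natrM.
  have K0 : 0 < (K n ^ d)%:R :> R by rewrite ltr0n !expn_gt0.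
  have AE : An n = (S (sqr_index h n))%:R / box_vol R d n.
    rewrite /An rE expr_div_n -vE -natrX; field; rewrite gt_eqF //= gt_eqF //.
  have BE : Bn n = (((4 * n).+1 ^ d)%:R - (K n ^ d * (4 * m).+1 ^ d)%:R) / box_vol R d n.
    rewrite /Bn rE mulrBl; congr (_ - _); last first.
      by rewrite exprMn expr_div_n -vE natrM !natrX mulrCA mulrA.
    rewrite natrX vE -expr_div_n; congr (_ ^+ _).
    rewrite -(@natr1 _ (4 * n)) natrM; field; rewrite gt_eqF //.
  rewrite AE BE -mulrBl normrM (gtr0_norm (_ : 0 < (box_vol R d n)^-1)) ?invr_gt0 //.
  rewrite ler_pM2r ?invr_gt0 // ler_norml.
  move: h1 h2; rewrite -!(ler_nat R) !natrD.
  by rewrite -/(K n); move=> h1 h2; apply/andP; split; lra.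
have e2 : 0 < e / 2 by rewrite divr_gt0.
move/cvgrPdist_le : cA => /(_ _ e2) cA.
move/cvgrPdist_le : cB => /(_ _ e2) cB.
near=> n.
have hn : (h <= n)%N by near: n; exists h.
have := key n hn.
have : `|a / (2 * h%:R) ^+ d - An n| <= e / 2 by near: n.
have : `|2 ^+ d - ((4 * m).+1%:R / (2 * h%:R)) ^+ d - Bn n| <= e / 2 by near: n.
rewrite !ler_norml => /andP[b1 b2] /andP[a1 a2] /andP[k1 k2].
by apply/andP; split; lra.
Unshelve. all: by end_near.
Qed.

(** With half-period m + r + 1, the gaps between blocks have bounded width and their share vanishes
    as m grows. *)
Lemma block_density_cvg d (r : nat) :
  (fun m => 2 ^+ d - ((4 * m).+1%:R / (2 * (m + r).+1%:R)) ^+ d : R) @ \oo --> (0 : R).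
Proof.
have lim2 : (fun m => (4 * m).+1%:R / (2 * (m + r).+1%:R) : R) @ \oo --> (2 : R).
  have -> : (fun m => (4 * m).+1%:R / (2 * (m + r).+1%:R) : R) =
            (fun m => 2 - ((4 * r)%:R + 3) / 2 * harmonic (m + r)%N).
    apply/funext => m; rewrite /harmonic /= -!natr1 !natrM natrD.
    have := ler0n R m; have := ler0n R r; move: (m%:R) (r%:R) => a b b0 a0; field.
    by rewrite gt_eqF //; lra.
  rewrite -[X in _ --> X]subr0; apply: cvgB; first exact: cvg_cst.
  rewrite -[X in _ --> X](mulr0 (((4 * r)%:R + 3) / 2)); apply: cvgM; first exact: cvg_cst.
  by have := @cvg_harmonic R; rewrite -(cvg_shiftn r).
rewrite -[X in _ --> X](subrr (2 ^+ d)); apply: cvgB; first exact: cvg_cst.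
exact: (cvg_comp _ _ lim2 (@exprn_continuous R d 2)).
Qed.

End Interpolation.

(** * Strong law for persistent Betti numbers *)

Section BettiLLN.
Context (R : realType) (dT : measure_display) (T : measurableType dT) (P : probability T R).
Context (d : nat) (X : T -> cube d -> \bar R) (Rd q : nat) (s t : R).
Hypothesis Xrcf : random_cubical_filtration P X.
Hypothesis Xstat : stationary P X.
Hypothesis Xdep : R_dependent P X Rd.

Local Notation pattern m := {ffun 'I_(nbox d m) -> bool * bool}.

Let state (x : \bar R) : bool * bool := ((x <= s%:E)%E, (x <= t%:E)%E).

(** Prescribing the pattern cube by cube makes the event a cylinder, as in the hypotheses on the
    law; a cube outside the box is left unconstrained. *)
Let pattern_set m (sigma : pattern m) (Q : cube d) : set (\bar R) :=
  [set x | forall k, bcube k = Q -> state x = sigma k].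

Let pattern_event m (sigma : pattern m) (z : 'I_d -> int) : set T :=
  cyl_event (fun w Q => X w (cube_shift z Q)) (box_cubes d m) (pattern_set sigma).

Let pattern_eventP m (sigma : pattern m) z w :
  pattern_event sigma z w <-> [ffun k => state (X w (cube_shift z (bcube k)))] = sigma.
Proof.
split=> [h|<- Q _ k <-]; last by rewrite ffunE.
by apply/ffunP => k; rewrite ffunE; apply: (h (bcube k)) => //; apply: mem_nth.
Qed.

Let measurable_le (u : R) (b : bool) : measurable [set x : \bar R | (x <= u%:E)%E = b].
Proof.
have m1 : measurable [set x : \bar R | (x <= u%:E)%E].
  by have := @emeasurable_itv R (Interval -oo%O (BRight u%:E)); rewrite set_itvNyc.
case: b; first exact: m1.
rewrite (_ : [set x | _] = ~` [set x : \bar R | (x <= u%:E)%E]); first exact: measurableC.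
by apply/seteqP; split=> x /=; [move=> ->|move/negP/negbTE].
Qed.

Let measurable_pattern_set m (sigma : pattern m) Q : measurable (pattern_set sigma Q).
Proof.
case: (pickP (fun k : 'I_(nbox d m) => bcube k == Q)) => [k /eqP kQ|none]; last first.
  rewrite (_ : pattern_set sigma Q = setT); first exact: measurableT.
  by apply/seteqP; split=> // x _ k /eqP; rewrite none.
rewrite (_ : pattern_set sigma Q =
   [set x | (x <= s%:E)%E = (sigma k).1] `&` [set x | (x <= t%:E)%E = (sigma k).2]).
  by apply: measurableI; exact: measurable_le.
apply/seteqP; split=> [x /(_ k kQ)|x [/= h1 h2] k'].
  by rewrite /state => <-.
by rewrite -kQ => /bcube_inj ->; rewrite /state h1 h2; case: (sigma k).
Qed.

(** R-dependence is stated for [X] itself, so the translation is moved from the field to the list of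
    cubes. *)
Let cyl_eventE (z : 'I_d -> int) (l : seq (cube d)) (B : cube d -> set (\bar R)) :
  cyl_event (fun w Q => X w (cube_shift z Q)) l B =
  cyl_event X (map (cube_shift z) l) (fun Q => B (cube_shift (fun i => - z i) Q)).
Proof.
apply/seteqP; split=> w h Q.
  by case/mapP => Q' /h hQ ->; rewrite cube_shiftK.
by move=> Ql; have := h _ (map_f (cube_shift z) Ql); rewrite cube_shiftK.
Qed.

Let measurable_cyl_event l (B : cube d -> set (\bar R)) :
  (forall Q, measurable (B Q)) -> measurable (cyl_event X l B).
Proof.
move=> mB; elim: l => [|Q l IH].
  by rewrite (_ : cyl_event _ _ _ = setT); [exact: measurableT|apply/seteqP; split].
rewrite (_ : cyl_event X (Q :: l) B = ((X ^~ Q) @^-1` B Q) `&` cyl_event X l B).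
  apply: measurableI => //; rewrite -[X in measurable X]setTI; exact: (Xrcf.2 Q).
apply/seteqP; split=> w; last first.
  by move=> [h1 h2] Q'; rewrite inE => /orP[/eqP ->|/h2].
by move=> h; split=> [|Q' Q'l]; apply: h; rewrite inE ?eqxx // Q'l orbT.
Qed.

Let measurable_pattern_event m (sigma : pattern m) z : measurable (pattern_event sigma z).
Proof. by rewrite /pattern_event cyl_eventE; apply: measurable_cyl_event => Q. Qed.

Let pattern_eventI m (sigma : pattern m) z z' i : ((m.*2 + Rd)%:Z < `|z i - z' i|) ->
  P (pattern_event sigma z `&` pattern_event sigma z') =
  (P (pattern_event sigma z) * P (pattern_event sigma z'))%E.
Proof.
move=> zz; rewrite /pattern_event !cyl_eventE; apply: Xdep => [Q1 Q2|Q|Q]; last 2 first.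
- exact: measurable_pattern_set.
- exact: measurable_pattern_set.
case/mapP => Q1' Q1m -> /mapP[Q2' Q2m ->].
by apply: (cube_dist_block zz); rewrite in_block_shift -mem_box_cubes.
Qed.

Let pattern_betti m (sigma : pattern m) : nat :=
  gbetti (bdry_mx R d m) (fun k => (cube_dim (bcube k) == q) && (sigma k).1)
    (fun k => (cube_dim (bcube k) == q.+1) && (sigma k).2).

Let pers_betti_pattern m z w : pers_betti (fun Q => X w (cube_shift z Q)) m q s t =
  pattern_betti ([ffun k => state (X w (cube_shift z (bcube k)))] : pattern m).
Proof. by apply: eq_gbetti => k; rewrite ffunE. Qed.

(** Exactly one pattern occurs in each sample. This reduces a law of large numbers for Betti numbers
    to one for events. *)
Let pers_betti_indic m z w :
  (pers_betti (fun Q => X w (cube_shift z Q)) m q s t)%:R =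
  \sum_(sigma : pattern m) (pattern_betti sigma)%:R * \1_(pattern_event sigma z) w :> R.
Proof.
rewrite pers_betti_pattern (bigD1 ([ffun k => state (X w (cube_shift z (bcube k)))] : pattern m)) //=.
rewrite big1 ?addr0 => [|sigma ne].
  by rewrite indicE mem_set ?mulr1 //; apply/pattern_eventP.
rewrite indicE memNset ?mulr0 // => /pattern_eventP e.
by rewrite e eqxx in ne.
Qed.

Lemma measurable_pers_betti n :
  measurable_fun setT (fun w => (pers_betti (X w) n q s t)%:R : R).
Proof.
have -> : (fun w => (pers_betti (X w) n q s t)%:R) = (fun w => \sum_(sigma : pattern n)
    (pattern_betti sigma)%:R * \1_(pattern_event sigma (fun=> 0)) w) :> (T -> R).
  apply/funext => w; rewrite -pers_betti_indic; congr (pers_betti _ _ _ _ _)%:R.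
  apply/funext => Q; congr (X w _).
  by apply/ffunP => i; rewrite ffunE addr0; case: (Q i).
apply: measurable_sum => sigma; apply: measurable_funM; first exact: measurable_cst.
by apply: measurable_indic; exact: measurable_pattern_event.
Qed.

Let block_lln m h : (0 < d)%N -> (m + Rd < h)%N -> exists a : R, {ae P, forall w,
  (fun k => (\sum_(j : {ffun 'I_d -> 'I_(k.+1 ^ 2)})
      pers_betti (fun Q => X w (cube_shift (grid_center h j) Q)) m q s t)%:R /
     ((k.+1 ^ 2) ^ d)%:R) @ \oo --> a}.
Proof.
move=> d0 mh; pose p (sigma : pattern m) := fine (P (cyl_event X (box_cubes d m) (pattern_set sigma))).
exists (\sum_(sigma : pattern m) (pattern_betti sigma)%:R * p sigma).
pose J k := [the finType of {ffun 'I_d -> 'I_(k.+1 ^ 2)}].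
pose E sigma k (j : J k) := @pattern_event m sigma (grid_center h j).
have cardJ k : #|J k| = ((k.+1 ^ 2) ^ d)%N by rewrite card_ffun !card_ord.
have PE sigma k (j : J k) : P (E sigma k j) = (p sigma)%:E.
  rewrite /p fineK; last by apply: fin_num_measure; exact: measurable_cyl_event.
  exact: Xstat.
have : {ae P, forall w, forall sigma : pattern m,
    (fun k => empirical_mean R (E sigma k) w) @ \oo --> p sigma}.
  apply: ae_forall_countable => sigma; apply: pairwise_lln.
  (* Here d > 0 ensures that there are at least (k+1)^2 blocks. *)
  - by move=> k; rewrite cardJ -{1}[(k.+1 ^ 2)%N]expn1 leq_pexp2l // expn_gt0.
  - by move=> k j; exact: measurable_pattern_event.
  - by move=> k j; exact: PE.
  - move=> k j j' /(grid_center_far mh)[i zi].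
    by rewrite [LHS](pattern_eventI sigma zi) -!/(E sigma k _) !PE.
apply: filterS => w hw.
rewrite (_ : (fun k => _) = (fun k => \sum_(sigma : pattern m) (pattern_betti sigma)%:R * empirical_mean R (E sigma k) w)).
  by apply: cvgr_sum => sigma; apply: cvgM; [exact: cvg_cst|exact: hw].
apply/funext => k; rewrite natr_sum.
under eq_bigr do rewrite pers_betti_indic.
rewrite exchange_big mulr_suml; apply: eq_bigr => sigma _.
by rewrite -mulr_sumr -mulrA /empirical_mean cardJ.
Qed.

(** The limit is not computed. For each m the sequence ends up in a band of half-width [em m] around
    the block mean, and [em m] tends to 0. *)
Lemma pers_betti_lln : (0 < d)%N -> exists c : R, {ae P, forall w,
  (fun n => (pers_betti (X w) n q s t)%:R / box_vol R d n) @ \oo --> c}.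
Proof.
move=> d0; pose h m := (m + Rd).+1.
pose em m : R := 2 ^+ d - ((4 * m).+1%:R / (2 * (h m)%:R)) ^+ d.
have em0 : em @ \oo --> (0 : R) := @block_density_cvg R d Rd.
have /choice[a ha] m := @block_lln m (h m) d0 (leqnn _).
pose u w n : R := (pers_betti (X w) n q s t)%:R / box_vol R d n.
have : {ae P, forall w, forall m, (forall e : R, 0 < e -> \forall n \near \oo,
    `|u w n - a m / (2 * (h m)%:R) ^+ d| <= em m + e)}.
  apply: ae_foralln => m; apply: filterS (ha m) => w hw e e0.
  apply: (interpolate_cvg (h := h m) (m := m) _ _ hw e0) => // k n kn.
  exact: (pers_betti_grid q (X w) s t (leqnn (m + Rd).+1) kn).
move=> ae_u.
(* Stated for two samples: with equal samples it is the Cauchy property, and with [w0] and [w] it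
   makes the limit independent of the sample. *)
have u_close w w' : (forall m, (forall e : R, 0 < e -> \forall n \near \oo,
    `|u w n - a m / (2 * (h m)%:R) ^+ d| <= em m + e)) ->
   (forall m, (forall e : R, 0 < e -> \forall n \near \oo,
    `|u w' n - a m / (2 * (h m)%:R) ^+ d| <= em m + e)) ->
   forall e, 0 < e -> \forall n \near \oo & n' \near \oo, `|u w n - u w' n'| <= e.
  move=> hw hw' e e0; have e4 : 0 < e / 4 by rewrite divr_gt0.
  move/cvgrPdist_le : em0 => /(_ _ e4) [m _ /(_ m (leqnn m))] /=.
  rewrite sub0r normrN => /ler_normlW emm.
  have [[A B] [/= hA hB] AB] : \forall n \near \oo & n' \near \oo,
      `|u w n - a m / (2 * (h m)%:R) ^+ d| <= em m + e / 4 /\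
      `|u w' n' - a m / (2 * (h m)%:R) ^+ d| <= em m + e / 4.
    exists ([set n | `|u w n - a m / (2 * (h m)%:R) ^+ d| <= em m + e / 4],
            [set n | `|u w' n - a m / (2 * (h m)%:R) ^+ d| <= em m + e / 4]); first by split; [exact: hw|exact: hw'].
    by move=> [n n'] [].
  exists (A, B); first by split.
  move=> [n n'] /AB /= []; rewrite !ler_norml => /andP[h1 h2] /andP[h3 h4].
  by apply/andP; split; lra.
have [w0 hw0] : exists w0, forall m, (forall e : R, 0 < e -> \forall n \near \oo,
    `|u w0 n - a m / (2 * (h m)%:R) ^+ d| <= em m + e).
  have PF : ProperFilter (almost_everywhere P).
    apply: ae_properfilter_algebraOfSetsType.
    by apply: (@lt_le_trans _ _ 1%E) => //; rewrite -(@probability_setT _ _ _ P).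
  exact: filter_ex ae_u.
have cu : cvgn (u w0).
  apply/cauchy_cvgP/cauchy_exP => e e0; have e2 : 0 < e / 2 by rewrite divr_gt0.
  have [[A B] [/= hA hB] AB] := u_close _ _ hw0 hw0 _ e2.
  have [n An] := filter_ex hA.
  exists (u w0 n); apply: filterS hB => n' Bn'.
  rewrite /ball /=; apply: le_lt_trans (AB (n, n') (conj An Bn')) _.
  by rewrite ltr_pdivrMr // mulr2n mulrDr mulr1 ltrDl.
exists (limn (u w0)); apply: filterS ae_u => w hw.
apply/cvgrPdist_le => e e0; have e2 : 0 < e / 2 by rewrite divr_gt0.
have [[A B] [/= hA hB] AB] := u_close _ _ hw0 hw _ e2.
have /cvgrPdist_le/(_ _ e2) hc := cu.
have [n [An cn]] := filter_ex (filterI hA hc).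
apply: filterS hB => n' Bn' /=.
have := AB (n, n') (conj An Bn'); move: cn => /=; rewrite -/(u w n').
rewrite !ler_norml => /andP[h1 h2] /andP[h3 h4].
by apply/andP; split; lra.
Qed.

End BettiLLN.

(** * Weak compactness for normalized point measures on the unit square *)

(** Compactness gives a cluster point, and a cluster point of an ultrafilter is a limit: a
    neighbourhood and its complement cannot both be missing from the ultrafilter. *)
Lemma ultra_bounded_cvg (R : realType) (G : set_system nat) (GU : UltraFilter G)
    (u : nat -> R) (C : R) : (forall n, 0 <= u n <= C) -> exists l : R, u @ G --> l.
Proof.
move=> u0C; have GF : ProperFilter G by exact: ultra_proper.
have [] := @segment_compact R 0 C (u @ G).
  by apply: (@filterS _ G _ setT) => [n _|]; [rewrite /= in_itv /= u0C|exact: filterT].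
move=> p [_ clp]; exists p => A pA.
have [//|nA] := in_ultra_setVsetC (u @^-1` A) GU.
have [x []] : (~` A) `&` A !=set0 by exact: clp.
by [].
Qed.

Lemma exists_nat_ceil (R : realType) (x : R) : 0 <= x -> exists k : nat, x <= k%:R < x + 1.
Proof.
move=> x0; exists `|Num.ceil x|%N.
rewrite natr_absz ger0_norm; last by rewrite ceil_ge0 (lt_le_trans _ x0) ?ltrN10.
by have /andP[h1 h2] := ceil_itv x; rewrite h2 -ltrBlDr; move: h1; rewrite intrB.
Qed.

Section WeakLimit.
Variable R : realType.
Implicit Types (p : R * R) (m i : nat).

Definition unit_square : set (R * R) := [set p | 0 <= p.1 <= 1 /\ 0 <= p.2 <= 1].

Definition has_modulus (f : R * R -> R) := forall e, 0 < e -> exists2 delta : R, 0 < delta &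
  forall p p', unit_square p -> unit_square p' ->
    `|p.1 - p'.1| <= delta -> `|p.2 - p'.2| <= delta -> `|f p - f p'| <= e.

Definition rat_threshold i : R := if @unpickle rat i is Some r then ratr r else 0.

(* The base-4 digits record on which side of each rational threshold the two coordinates lie,
   so that codes refine each other and points with equal codes are close. *)
Fixpoint cell_code m p : nat :=
  if m is m'.+1 then
    (4 * cell_code m' p + (2 * (rat_threshold m' < p.1)%R + (rat_threshold m' < p.2)%R))%N
  else 0%N.

Lemma cell_code_lt m p : (cell_code m p < 4 ^ m)%N.
Proof.
elim: m => //= m IH; rewrite expnS; have := leq_mul2l 4 (cell_code m p).+1 (4 ^ m).
by rewrite IH orbT; case: (_ < _); case: (_ < _); lia.
Qed.

Lemma cell_code_div m p : (cell_code m.+1 p %/ 4)%N = cell_code m p.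
Proof.
rewrite /= mulnC divnMDl // divn_small ?addn0 //.
by case: (_ < _); case: (_ < _).
Qed.

Lemma cell_code_le m m' p p' : (m <= m')%N ->
  cell_code m' p = cell_code m' p' -> cell_code m p = cell_code m p'.
Proof.
move=> mm'; rewrite -(subnK mm'); elim: (m' - m)%N => [//|k IH] h; apply: IH.
by rewrite -!(cell_code_div (k + m)) -addSn h.
Qed.

Lemma cell_code_threshold m p p' i : (i < m)%N -> cell_code m p = cell_code m p' ->
  (rat_threshold i < p.1) = (rat_threshold i < p'.1) /\
  (rat_threshold i < p.2) = (rat_threshold i < p'.2).
Proof.
move=> im /(cell_code_le im) /=.
by case: (_ < p.1); case: (_ < p.2); case: (_ < p'.1); case: (_ < p'.2); split=> //; lia.
Qed.

Lemma cell_code_close (delta : R) : 0 < delta -> exists m0, forall m, (m0 <= m)%N ->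
  forall p p', cell_code m p = cell_code m p' -> unit_square p -> unit_square p' ->
    `|p.1 - p'.1| <= delta /\ `|p.2 - p'.2| <= delta.
Proof.
move=> d0; pose N := (Num.truncn delta^-1).+1.
have Nd : delta^-1 < N%:R by rewrite /N truncnS_gt // invr_ge0 ltW.
have N0 : 0 < N%:R :> R by rewrite ltr0n.
have iNd : N%:R^-1 < delta by rewrite invf_plt ?posrE.
pose r (k : nat) : rat := k%:R / N%:R.
exists (\max_(k < N.+1) (pickle (r k)).+1)%N => m mm p p' pp' sp sp'.
have th k x x' : (k <= N)%N -> (forall i, (i < m)%N -> (rat_threshold i < x) = (rat_threshold i < x')) ->
    (k%:R / N%:R < x) = (k%:R / N%:R < x' :> R).
  move=> kN h; have := h (pickle (r k)); rewrite /rat_threshold pickleK /r.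
  rewrite fmorph_div /= !ratr_nat; apply; apply: leq_trans mm.
  exact: (leq_bigmax (Ordinal (kN : (k < N.+1)%N))).
have close x x' : 0 <= x -> x' <= 1 ->
    (forall i, (i < m)%N -> (rat_threshold i < x) = (rat_threshold i < x')) -> x' - x <= delta.
  (* Were x' larger than x + delta, the first multiple of 1/N at or above x would lie strictly below
     x' and separate the two points. *)
  move=> x0 x'1 h; rewrite leNgt; apply/negP => dx.
  have [k /andP[k1 k2]] := exists_nat_ceil (mulr_ge0 x0 (ltW N0)).
  have xk : x <= k%:R / N%:R by rewrite ler_pdivlMr.
  have kx' : k%:R / N%:R < x'.
    rewrite ltr_pdivrMr //; apply: lt_le_trans k2 _.
    have : x + N%:R^-1 <= x' by lra.
    by move=> /(ler_wpM2r (ltW N0)); rewrite mulrDl mulVf ?gt_eqF.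
  have kN : (k <= N)%N.
    by rewrite -(ler_nat R) -[leRHS]mul1r -ler_pdivrMr // (le_trans (ltW kx')).
  by have := th k x x' kN h; rewrite kx' ltNge xk.
have h i (im : (i < m)%N) := cell_code_threshold im pp'.
case: sp sp' => /andP[a1 a2] /andP[b1 b2] [/andP[a1' a2'] /andP[b1' b2']].
split; rewrite ler_norml; apply/andP; split.
- by rewrite lerNl opprB; apply: close => // i /h[].
- by apply: close => // i /h[].
- by rewrite lerNl opprB; apply: close => // i /h[].
- by apply: close => // i /h[].
Qed.


Variables (L : nat -> seq (R * R)) (c : nat -> R) (C : R).
Hypothesis c0 : forall n, 0 <= c n.
Hypothesis cL : forall n, c n * (size (L n))%:R <= C.
Hypothesis Lsq : forall n p, p \in L n -> unit_square p.
Variables (G : set_system nat) (GU : UltraFilter G).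

Let GF : ProperFilter G := @ultra_proper _ _ GU.

(** A distribution function for the weighted points, the cells being ordered by their codes; [cumul]
    is its limit along the ultrafilter. *)
Definition mass_below m i n : R := c n * (count (fun p => cell_code m p < i)%N (L n))%:R.

Lemma mass_below_bounded m i n : 0 <= mass_below m i n <= C.
Proof.
rewrite mulr_ge0 //=; apply: le_trans (cL n).
by rewrite ler_wpM2l // ler_nat count_size.
Qed.

Definition cumul m i : R := sval (cid (ultra_bounded_cvg GU (mass_below_bounded m i))).

Lemma cumulP m i : mass_below m i @ G --> cumul m i.
Proof. exact: svalP (cid (ultra_bounded_cvg GU (mass_below_bounded m i))). Qed.

Arguments cumulP : clear implicits.

Lemma cumul_unique m i (l : R) : mass_below m i @ G --> l -> cumul m i = l.
Proof.
by move=> /(cvg_lim (@Rhausdorff R)) <-; apply/esym/(cvg_lim (@Rhausdorff R)); exact: cumulP.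
Qed.

Lemma cumul_eq m i m' i' : (forall n, mass_below m i n = mass_below m' i' n) ->
  cumul m i = cumul m' i'.
Proof.
move=> e; apply: cumul_unique.
by rewrite (_ : mass_below m i = mass_below m' i'); [exact: cumulP|exact/funext].
Qed.

Lemma cumul_le m i i' : (i <= i')%N -> cumul m i <= cumul m i'.
Proof.
move=> ii'; apply: (ler_cvg_to (cumulP m i) (cumulP m i')).
apply: nearW => n; rewrite ler_wpM2l // ler_nat; apply: sub_count => p /=.
by move=> /leq_trans; apply.
Qed.

Lemma cumul0 m : cumul m 0 = 0.
Proof.
apply: cumul_unique.
rewrite (_ : mass_below m 0 = fun=> 0); first exact: cvg_cst.
by apply/funext => n; rewrite /mass_below (eq_count (a2 := pred0)) // count_pred0 mulr0.
Qed.

(** The children of cell [i] have the codes 4i to 4i + 3, so the distribution functions of all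
    levels are compatible. *)
Lemma cumul_refine m i : cumul m.+1 (4 * i) = cumul m i.
Proof.
apply: cumul_eq => n; congr (_ * _%:R); apply: eq_count => p.
by rewrite mulnC -ltn_divLR // cell_code_div.
Qed.

Definition total_mass : R := cumul 0 1.

Lemma cumul_total m : cumul m (4 ^ m) = total_mass.
Proof. by elim: m => // m IH; rewrite expnS cumul_refine. Qed.

Lemma total_mass_ge0 : 0 <= total_mass.
Proof. by rewrite -(cumul0 0); apply: cumul_le. Qed.

Definition cell m i : set R := `[cumul m i, cumul m i.+1[.

Lemma cell_exists m r : 0 <= r < total_mass -> exists2 i, (i < 4 ^ m)%N & cell m i r.
Proof.
move=> /andP[r0 rT].
have ex : exists i, cumul m i <= r by exists 0%N; rewrite cumul0.
have bd i : cumul m i <= r -> (i <= 4 ^ m)%N.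
  move=> h; rewrite leqNgt; apply/negP => /ltnW/(cumul_le m).
  by rewrite cumul_total => /(lt_le_trans rT); rewrite ltNge h.
case: (ex_maxnP ex bd) => i ir imax; exists i.
  rewrite ltnNge; apply/negP => /(cumul_le m); rewrite cumul_total => h.
  by have := lt_le_trans rT (le_trans h ir); rewrite ltxx.
rewrite /cell /= in_itv /= ir ltNge; apply/negP => /imax.
by rewrite ltnn.
Qed.

Lemma cell_unique m i i' r : cell m i r -> cell m i' r -> i = i'.
Proof.
rewrite /cell /= !in_itv /= => /andP[h1 h2] /andP[h3 h4].
have aux j j' : cumul m j <= r -> r < cumul m j'.+1 -> (j <= j')%N.
  move=> hj hj'; rewrite leqNgt; apply/negP => /(cumul_le m) h.
  by have := lt_le_trans hj' (le_trans h hj); rewrite ltxx.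
by apply/eqP; rewrite eqn_leq !aux.
Qed.

Lemma cell_div m i r : cell m.+1 i r -> cell m (i %/ 4) r.
Proof.
rewrite /cell /= !in_itv /= -!(cumul_refine m) => /andP[h1 h2]; apply/andP; split.
  by apply: le_trans h1; apply: cumul_le; rewrite mulnC leq_trunc_div.
apply: lt_le_trans h2 _; apply: cumul_le.
by rewrite mulnC -ltn_divLR.
Qed.

Definition cell_point m i : R * R :=
  xget (0, 0) [set p | unit_square p /\ cell_code m p = i].

Lemma unit_square_cell_point m i : unit_square (cell_point m i).
Proof.
rewrite /cell_point; case: xgetP => [p _ []//|_].
by rewrite /unit_square /= lexx ler01.
Qed.

Lemma cell_code_point m i p : unit_square p -> cell_code m p = i ->
  cell_code m (cell_point m i) = i.
Proof.
move=> sp pi; have [] := @xgetPex _ (0, 0) [set p | unit_square p /\ cell_code m p = i] => //.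
by exists p.
Qed.

(** A code that no point of the square has carries no mass, so its interval is empty; the default of
    [cell_point] never arises over a nonempty interval. *)
Lemma cell_code_cell_point m i r : cell m i r -> cell_code m (cell_point m i) = i.
Proof.
move=> ir; have [[p [sp pi]]|none] := pselect (exists p, unit_square p /\ cell_code m p = i).
  exact: cell_code_point sp pi.
have : cumul m i.+1 = cumul m i.
  apply: cumul_eq => n; congr (_ * _%:R); apply: eq_in_count => p pL.
  rewrite ltnS leq_eqVlt; case: eqP => //= pi; case: none; exists p; split=> //.
  exact: Lsq pL.
by move: ir; rewrite /cell /= in_itv /= => /andP[h1 h2] e; move: h2; rewrite e ltNge h1.
Qed.

(* A quantile map: the cell with code i is hit on an interval whose length is its limit mass. *)
Definition step_map m (r : R) : R * R :=
  (\sum_(i < 4 ^ m) (cell_point m i).1 * \1_(cell m i) r,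
   \sum_(i < 4 ^ m) (cell_point m i).2 * \1_(cell m i) r).

Lemma sum_cell m (F : nat -> R) i r : (i < 4 ^ m)%N -> cell m i r ->
  \sum_(j < 4 ^ m) F j * \1_(cell m j) r = F i.
Proof.
move=> im ir; rewrite (bigD1 (Ordinal im)) //= indicE mem_set // mulr1.
rewrite big1 ?addr0 // => j ji; rewrite indicE memNset ?mulr0 // => jr.
by move/negP: ji; apply; apply/eqP/val_inj; exact: cell_unique jr ir.
Qed.

Lemma step_mapE m i r : (i < 4 ^ m)%N -> cell m i r -> step_map m r = cell_point m i.
Proof.
move=> im ir; rewrite /step_map (sum_cell (fun j => (cell_point m j).1) im ir).
by rewrite (sum_cell (fun j => (cell_point m j).2) im ir); case: cell_point.
Qed.

Lemma step_map_square m r : 0 <= r < total_mass -> unit_square (step_map m r).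
Proof.
by move=> /(cell_exists m)[i im ir]; rewrite (step_mapE im ir); exact: unit_square_cell_point.
Qed.

(** Refining the level keeps the image in the same coarse cell. Hence the step maps are uniformly
    Cauchy on the interval of length [total_mass]. *)
Lemma step_map_code m m' r : 0 <= r < total_mass -> (m <= m')%N ->
  cell_code m (step_map m' r) = cell_code m (step_map m r).
Proof.
move=> rT mm'; rewrite -(subnK mm'); elim: (m' - m)%N => [//|k IH].
rewrite -{}IH addSn; apply: (@cell_code_le _ (k + m)); first exact: leq_addl.
have [i im ir] := cell_exists (k + m).+1 rT; have [j jm jr] := cell_exists (k + m) rT.
rewrite (step_mapE im ir) (step_mapE jm jr) (cell_code_cell_point jr).
rewrite -cell_code_div (cell_code_cell_point ir).
exact: cell_unique (cell_div ir) jr.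
Qed.

Lemma step_map_close (delta : R) : 0 < delta -> exists m0, forall m m' r,
  (m0 <= m)%N -> (m0 <= m')%N -> 0 <= r < total_mass ->
  `|(step_map m r).1 - (step_map m' r).1| <= delta /\
  `|(step_map m r).2 - (step_map m' r).2| <= delta.
Proof.
move=> d0; have [m0 hm0] := cell_code_close d0; exists m0 => m m' r mm mm' rT.
apply: (hm0 m0); rewrite ?step_map_code //; exact: step_map_square.
Qed.

Definition limit_map (r : R) : R * R :=
  (limn (fun m => (step_map m r).1), limn (fun m => (step_map m r).2)).

(** The rest of the line, of infinite Lebesgue measure, is sent to the corner (0, 0). The corner
    lies outside Delta, whence the condition [~ D (0, 0)] in the results on the image measure. *)
Lemma step_map_outside m r : ~~ (0 <= r < total_mass) -> step_map m r = (0, 0).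
Proof.
move=> rT; rewrite /step_map !big1 // => i _; rewrite indicE memNset ?mulr0 // => ir;
  move/negP: rT; apply; move: ir; rewrite /cell /= in_itv /= => /andP[h1 h2];
  rewrite (le_trans _ h1) -?(cumul0 m) ?cumul_le //= -(cumul_total m);
  by apply: lt_le_trans h2 _; apply: cumul_le.
Qed.

Lemma step_map_cvg r : (fun m => (step_map m r).1) @ \oo --> (limit_map r).1 /\
  (fun m => (step_map m r).2) @ \oo --> (limit_map r).2.
Proof.
have [rT|rT] := boolP (0 <= r < total_mass); last first.
  have e1 : (fun m => (step_map m r).1) = (fun=> 0).
    by apply/funext => m; rewrite step_map_outside.
  have e2 : (fun m => (step_map m r).2) = (fun=> 0).
    by apply/funext => m; rewrite step_map_outside.
  by rewrite /limit_map /= e1 e2; split; exact: is_cvg_cst.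
have cau (h : R * R -> R) : (forall delta : R, 0 < delta -> exists m0, forall m m',
    (m0 <= m)%N -> (m0 <= m')%N -> `|h (step_map m r) - h (step_map m' r)| <= delta) ->
    cvgn (fun m => h (step_map m r)).
  move=> hh; apply/cauchy_cvgP/cauchy_exP => e e0.
  have e2 : 0 < e / 2 by rewrite divr_gt0.
  have [m0 hm0] := hh _ e2.
  exists (h (step_map m0 r)); exists m0 => // m /= mm.
  rewrite /ball /=; apply: le_lt_trans (hm0 _ _ (leqnn _) mm) _.
  by rewrite ltr_pdivrMr // mulr2n mulrDr mulr1 ltrDl.
by split; apply: cau => delta /step_map_close[m0 hm0]; exists m0 => m m' mm mm';
  have [] := hm0 m m' r mm mm' rT.
Qed.

Lemma limit_map_close (delta : R) : 0 < delta -> exists m0, forall m r,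
  (m0 <= m)%N -> 0 <= r < total_mass ->
  `|(step_map m r).1 - (limit_map r).1| <= delta /\
  `|(step_map m r).2 - (limit_map r).2| <= delta.
Proof.
move=> d0; have [m0 hm0] := step_map_close d0; exists m0 => m r mm rT.
have [c1 c2] := step_map_cvg r.
split.
  apply: (@closed_cvg _ _ \oo _ (fun m' => `|(step_map m r).1 - (step_map m' r).1|) [set x | x <= delta]).
  - exact: closed_le.
  - by exists m0 => // m' mm'; have [] := hm0 m m' r mm mm' rT.
  - by apply: cvg_norm; apply: cvgB => //; exact: cvg_cst.
apply: (@closed_cvg _ _ \oo _ (fun m' => `|(step_map m r).2 - (step_map m' r).2|) [set x | x <= delta]).
- exact: closed_le.
- by exists m0 => // m' mm'; have [] := hm0 m m' r mm mm' rT.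
- by apply: cvg_norm; apply: cvgB => //; exact: cvg_cst.
Qed.

Lemma limit_map_square r : unit_square (limit_map r).
Proof.
have sq m : unit_square (step_map m r).
  have [rT|rT] := boolP (0 <= r < total_mass); first exact: step_map_square.
  by rewrite step_map_outside // /unit_square /= lexx ler01.
have [c1 c2] := step_map_cvg r; split; apply/andP; split.
- by apply: (cvgr_to_ge c1); apply: nearW => m; have [/andP[]] := sq m.
- by apply: (cvgr_to_le c1); apply: nearW => m; have [/andP[]] := sq m.
- by apply: (cvgr_to_ge c2); apply: nearW => m; have [_ /andP[]] := sq m.
- by apply: (cvgr_to_le c2); apply: nearW => m; have [_ /andP[]] := sq m.
Qed.

Lemma measurable_limit_map : measurable_fun (setT : set (measurableTypeR R)) limit_map.
Proof.
have mc m i : measurable (cell m i) by exact: measurable_itv.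
apply: (@measurable_fun_pair _ _ _ _ _ _ (fun r => (limit_map r).1) (fun r => (limit_map r).2)).
  apply: (@measurable_fun_cvg _ _ _ _ (fun m r => (step_map m r).1)) => [m|r _].
    by apply: measurable_sum => i; apply: measurable_funM.
  by have [] := step_map_cvg r.
apply: (@measurable_fun_cvg _ _ _ _ (fun m r => (step_map m r).2)) => [m|r _].
  by apply: measurable_sum => i; apply: measurable_funM.
by have [] := step_map_cvg r.
Qed.


Let leb : {measure set (measurableTypeR R) -> \bar R} := @lebesgue_measure R.
Let support : set (measurableTypeR R) := `[0, total_mass[.

Let leb_support : leb support = total_mass%:E.
Proof.
rewrite [LHS](lebesgue_measure_itv `[0, total_mass[%R) /= lte_fin.
by case: ltP => [_|T0]; rewrite ?oppr0 ?adde0 //; congr _%:E; apply/eqP; rewrite eq_le total_mass_ge0 T0.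
Qed.

Let msupport : measurable support. Proof. exact: measurable_itv. Qed.

Variables (f : R * R -> R) (mf : measurable_fun setT f) (fmod : has_modulus f).

(** Finitely many cells cover the square and [f] varies by at most 1 on each, so the values at the
    representatives bound it. *)
Lemma has_modulus_bounded : exists2 B, 0 < B & forall p, unit_square p -> `|f p| <= B.
Proof.
have [delta d0 hd] := fmod ltr01.
have [m0 hm0] := cell_code_close d0.
pose B := \sum_(i < 4 ^ m0) `|f (cell_point m0 i)|.
exists (B + 1) => [|p sp]; first by rewrite ltr_pwDr // sumr_ge0.
have pi := cell_code_point sp (erefl (cell_code m0 p)).
have [h1 h2] := hm0 m0 (leqnn _) _ _ (esym pi) sp (unit_square_cell_point _ _).
have := hd _ _ sp (unit_square_cell_point _ _) h1 h2.
rewrite -[f p](subrK (f (cell_point m0 (cell_code m0 p)))) => h3.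
apply: (le_trans (ler_normD _ _)); rewrite addrC; apply: lerD => //.
  rewrite /B (bigD1 (Ordinal (cell_code_lt m0 p))) //= lerDl sumr_ge0 //.
by move: h3; rewrite subrK.
Qed.

Let integrable_bounded (g : R -> R) (B : R) : measurable_fun support g ->
  (forall r, support r -> `|g r| <= B) -> leb.-integrable support (EFin \o g).
Proof.
move=> mg gB; apply: measurable_bounded_integrable => //.
  by rewrite leb_support ltry.
exists B; split; first exact: num_real.
by move=> x Bx r /gB /le_trans; apply; exact: ltW.
Qed.

Let mflim : measurable_fun support (fun r => f (limit_map r)).
Proof.
apply: (@measurable_funS _ _ _ _ setT) => //.
by apply: (@measurableT_comp _ _ _ _ _ _ f) => //; exact: measurable_limit_map.
Qed.

Let step_integral m : \int[leb]_(r in support) f (step_map m r) =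
  \sum_(i < 4 ^ m) f (cell_point m i) * (cumul m i.+1 - cumul m i).
Proof.
have mc i : measurable (cell m i : set (measurableTypeR R)) by exact: measurable_itv.
rewrite (@eq_Rintegral _ _ _ _ support (fun r => \sum_(i < 4 ^ m) f (cell_point m i) * \1_(cell m i) r)); last first.
  move=> r; rewrite inE /support /= in_itv /= => /(cell_exists m)[i im ir].
  by rewrite (step_mapE im ir) (sum_cell (fun i => f (cell_point m i)) im ir).
rewrite /Rintegral.
have intI i : leb.-integrable support (fun r => (f (cell_point m i) * \1_(cell m i) r)%:E).
  apply: (@integrable_bounded (fun r => f (cell_point m i) * \1_(cell m i) r) `|f (cell_point m i)|) => [|r _].
    by apply: measurable_funM; [exact: measurable_cst|by apply: measurable_indic; apply: mc].
  by rewrite normrM ler_piMr // indicE; case: (_ \in _); rewrite ?normr1 ?normr0.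
under eq_integral do rewrite -sumEFin.
rewrite integral_sum //.
rewrite (eq_bigr (fun i : 'I_(4 ^ m) => (f (cell_point m i) * (cumul m i.+1 - cumul m i))%:E)).
  by rewrite sumEFin.
move=> i _; under eq_integral do rewrite EFinM.
rewrite integralZl //; last first.
  apply: (@integrable_bounded (\1_(cell m i)) 1) => [|r _]; first by apply: measurable_indic; apply: mc.
  by rewrite indicE; case: (_ \in _); rewrite ?normr1 ?normr0.
rewrite [RHS]EFinM; congr (_ * _)%E.
rewrite integral_indic //.
rewrite (_ : cell m i `&` support = cell m i); last first.
  apply/setIidPl => r; rewrite /cell /support /= !in_itv /= => /andP[h1 h2].
  rewrite (le_trans _ h1) -?(cumul0 m) ?cumul_le //= -(cumul_total m).
  by apply: lt_le_trans h2 _; apply: cumul_le.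
rewrite [LHS](lebesgue_measure_itv `[cumul m i, cumul m i.+1[%R) /= lte_fin.
case: ltP => [_|e]; first by rewrite EFinB.
by congr _%:E; apply/esym/eqP; rewrite subr_eq0 eq_le e cumul_le.
Qed.

(** After rounding points to cell representatives, the sum is a finite linear combination of
    increments of [mass_below], which converge along the ultrafilter. *)
Let step_sum_cvg m :
  (fun n => c n * \sum_(p <- L n) f (cell_point m (cell_code m p))) @ G -->
  \int[leb]_(r in support) f (step_map m r).
Proof.
rewrite step_integral.
rewrite (_ : (fun n => _) = (fun n => \sum_(i < 4 ^ m) f (cell_point m i) * (mass_below m i.+1 n - mass_below m i n))).
  apply: cvgr_sum => i; apply: cvgM; first exact: cvg_cst.
  by apply: cvgB; exact: cumulP.
apply/funext => n; rewrite /mass_below.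
transitivity (\sum_(i < 4 ^ m) f (cell_point m i) * (c n * (count (fun p => cell_code m p == i) (L n))%:R)).
  rewrite (eq_bigr (fun i : 'I_(4 ^ m) => c n * \sum_(p <- L n) f (cell_point m i) * (cell_code m p == i)%:R)); last first.
    move=> i _; rewrite mulrCA; congr (_ * _); rewrite -mulr_sumr; congr (_ * _).
    by rewrite -sum1_count natr_sum big_mkcond /=; apply: eq_bigr => p _; case: eqP.
  rewrite -mulr_sumr exchange_big; congr (_ * _); apply: eq_bigr => p _.
  rewrite (bigD1 (Ordinal (cell_code_lt m p))) //= eqxx mulr1 big1 ?addr0 // => i ip.
  by case: eqP => [e|]; rewrite ?mulr0 //; move: ip; rewrite -val_eqE /= e eqxx.
apply: eq_bigr => i _; rewrite -mulrBr -natrB; last first.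
  by apply: sub_count => p /=; exact: ltnW.
congr (_ * (_ * _%:R)).
have := @count_addE _ (fun p => cell_code m p < i.+1)%N pred0
  (fun p => cell_code m p == i) (fun p => cell_code m p < i)%N (L n).
rewrite count_pred0 addn0 => cE; rewrite cE ?addnK // => p _.
by rewrite /= addn0 ltnS leq_eqVlt; case: eqP => [->|]; rewrite ?ltnn ?addn0.
Qed.

Lemma limit_map_integral :
  (fun n => c n * \sum_(p <- L n) f p) @ G --> \int[leb]_(r in support) f (limit_map r).
Proof.
have C0 : 0 <= C by have /andP[/le_trans] := mass_below_bounded 0 0 0; apply.
apply/cvgrPdist_le => e e0.
(* The precision e / K is spent three times: on the integral (times [total_mass]), on the sums
   (times [C]) and on the convergence of the rounded sums (times 1). *)
pose K := C + total_mass + 1.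
have T0 := total_mass_ge0.
have K0 : 0 < K by rewrite /K; lra.
have e1 : 0 < e / K by rewrite divr_gt0.
have [delta d0 hd] := fmod e1.
have [m0 hm0] := cell_code_close d0.
have [m1 hm1] := limit_map_close d0.
pose m := maxn m0 m1.
have hint : `|\int[leb]_(r in support) f (limit_map r) - \int[leb]_(r in support) f (step_map m r)|
    <= e / K * total_mass.
  have [B B0 fB] := has_modulus_bounded.
  have i1 : leb.-integrable support (EFin \o (fun r => f (limit_map r))).
    by apply: (integrable_bounded mflim (B := B)) => r _; apply: fB; exact: limit_map_square.
  have mstep : measurable_fun support (fun r => f (step_map m r)).
    apply: (@measurable_funS _ _ _ _ setT) => //.
    apply: (@measurableT_comp _ _ _ _ _ _ f) => //; apply: measurable_fun_pair;
      by apply: measurable_sum => i; apply: measurable_funM => //; apply: measurable_indic; exact: measurable_itv.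
  have i2 : leb.-integrable support (EFin \o (fun r => f (step_map m r))).
    apply: (@integrable_bounded _ B) => // r; rewrite /support /= in_itv /= => rT.
    by apply: fB; exact: step_map_square.
  have i3 : leb.-integrable support (EFin \o (fun r => f (limit_map r) - f (step_map m r))).
    exact: (integrableB msupport i1 i2).
  rewrite -RintegralB //; apply: (le_trans (le_normr_Rintegral msupport i3)).
  have -> : e / K * total_mass = \int[leb]_(r in support) (e / K).
    by rewrite Rintegral_cst // leb_support.
  apply: le_Rintegral => //.
  - by have := integrable_abse i3.
  - by apply: (@integrable_bounded (cst (e / K)) (e / K)) => // r _; rewrite gtr0_norm.
  move=> r; rewrite /support /= in_itv /= => rT.
  have [h1 h2] := hm1 m r (leq_maxr _ _) rT.
  by rewrite distrC; apply: hd => //; [exact: step_map_square|exact: limit_map_square].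
have hn n : `|c n * \sum_(p <- L n) f p - c n * \sum_(p <- L n) f (cell_point m (cell_code m p))| <= e / K * C.
  rewrite -mulrBr normrM ger0_norm // -sumrB.
  apply: (@le_trans _ _ (c n * (e / K * (size (L n))%:R))); last first.
    by rewrite mulrCA ler_wpM2l // ltW.
  rewrite ler_wpM2l //; apply: (le_trans (ler_norm_sum _ _ _)).
  rewrite mulr_natr -[size _]count_predT -sum1_count -sumrMnr big_seq [leRHS]big_seq.
  apply: ler_sum => p pL; rewrite mulr1n.
  have sp := Lsq pL; have pi := cell_code_point sp (erefl (cell_code m p)).
  have [h1 h2] := hm0 m (leq_maxl _ _) _ _ (esym pi) sp (unit_square_cell_point _ _).
  by apply: hd => //; exact: unit_square_cell_point.
have eK : e / K * total_mass + e / K + e / K * C = e.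
  rewrite -[RHS](divfK (lt0r_neq0 K0)); move: (e / K) => k; rewrite /K; ring.
have /cvgrPdist_le/(_ _ e1) := @step_sum_cvg m.
apply: filterS => n; move: (hn n) hint.
rewrite !ler_norml => /andP[a1 a2] /andP[b1 b2] /andP[h1 h2].
by apply/andP; split; lra.
Qed.

Lemma limit_map_support (D : set (R * R)) r : ~ D (0, 0) -> D (limit_map r) -> support r.
Proof.
move=> D0 Dr; rewrite /support /= in_itv /=; apply: contrapT => /negP rT.
apply: D0; have e m : step_map m r = (0, 0) by rewrite step_map_outside.
suff <- : limit_map r = (0, 0) by [].
rewrite /limit_map (_ : (fun m => (step_map m r).1) = fun=> 0); last first.
  by apply/funext => m; rewrite e.
rewrite (_ : (fun m => (step_map m r).2) = fun=> 0); last by apply/funext => m; rewrite e.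
by rewrite !lim_cst.
Qed.

Lemma limit_measure_integral (D : set (R * R)) : measurable D -> ~ D (0, 0) ->
  (forall p, ~ D p -> f p = 0) ->
  exists2 I : R, (fun n => c n * \sum_(p <- L n) f p) @ G --> I &
    (\int[pushforward leb limit_map]_(p in D) (f p)%:E)%E = I%:E.
Proof.
move=> mD D0 fD.
have [B B0 fB] := has_modulus_bounded.
have out r := limit_map_support (r := r) D0.
have i1 : leb.-integrable support (EFin \o (fun r => f (limit_map r))).
  by apply: (integrable_bounded mflim (B := B)) => r _; apply: fB; exact: limit_map_square.
have mDlim : measurable (limit_map @^-1` D).
  by rewrite -[X in measurable X]setTI; exact: measurable_limit_map.
exists (\int[leb]_(r in support) f (limit_map r)); first exact: limit_map_integral.
rewrite (@integral_pushforward _ _ _ _ _ _ measurable_limit_map leb D (fun p => (f p)%:E)) //; last 2 first.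
- exact/measurable_EFinP.
- by apply: (integrableS _ _ _ i1).
rewrite /Rintegral fineK; last exact: integrable_fin_num.
(* The preimage of [D] lies in the support and [f] vanishes off [D], so both domains give the same
   integrand. *)
rewrite integral_mkcond [RHS]integral_mkcond; congr (integral _ _ _).
apply/funext => r; rewrite /patch.
case: ifPn => rD; case: ifPn => rS //.
- by move: rS; rewrite notin_setE => /(_ (out r (set_mem rD))).
- by rewrite fD //; move: rD; rewrite notin_setE.
Qed.

(* [lebesgue_measure] is an outer measure, hence monotone on arbitrary sets. *)
Lemma limit_measure_lty (A : set (R * R)) : ~ A (0, 0) ->
  (pushforward leb limit_map A < +oo)%E.
Proof.
move=> A0; apply: (@le_lt_trans _ _ (leb support)); last by rewrite leb_support ltry.
by apply: le_mu_ext => r; exact: limit_map_support.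
Qed.

End WeakLimit.

(** Since [G] refines [\oo], every ordinary limit is also a limit along [G]; this is how the measure
    is later tied to the actual sequence. *)
Lemma exists_weak_limit (R : realType) (L : nat -> seq (R * R)) (c : nat -> R) (C : R) :
  (forall n, 0 <= c n) -> (forall n, c n * (size (L n))%:R <= C) ->
  (forall n p, p \in L n -> unit_square p) ->
  exists (G : set_system nat) (nu : {measure set (R * R) -> \bar R}),
    [/\ ProperFilter G, \oo `<=` G, (forall A, ~ A (0, 0) -> (nu A < +oo)%E) &
      forall (D : set (R * R)) (f : R * R -> R), measurable D -> ~ D (0, 0) ->
        measurable_fun setT f -> has_modulus f -> (forall p, ~ D p -> f p = 0) ->
        exists2 I : R, (fun n => c n * \sum_(p <- L n) f p) @ G --> I &
          (\int[nu]_(p in D) (f p)%:E)%E = I%:E].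
Proof.
move=> c0 cL Lsq; have [G [GU ooG]] := ultraFilterLemma (eventually_filter : ProperFilter (\oo : set_system nat)).
exists G; pose g := limit_map c0 cL GU.
have mg : measurable_fun setT g := measurable_limit_map c0 cL Lsq GU.
pose nu := measure_function_pushforward__canonical__measure_function_Measure (@lebesgue_measure R) mg.
exists nu; split=> //.
- exact: ultra_proper.
- by move=> A A0; exact: limit_measure_lty.
- by move=> D f mD D0 mf fmod fD; exact: limit_measure_integral.
Qed.

(** * Grid approximation of test functions on Delta *)

Section Grid.
Variable R : realType.
Implicit Types (p : R * R) (N j k : nat) (f g : R * R -> R).

Lemma sub_Delta01_square : @Delta01 R `<=` @unit_square R.
Proof.
move=> [x y] [/= x0 [xy y1]]; have y0 := ltW (le_lt_trans x0 xy).
by split; rewrite /= ?x0 ?y0 ?y1 ?(le_trans (ltW xy)).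
Qed.

Lemma Delta01_0 : ~ @Delta01 R (0, 0).
Proof. by move=> [_ [/=]]; rewrite ltxx. Qed.

Lemma measurable_Delta01 : measurable (@Delta01 R).
Proof.
have -> : @Delta01 R = (fst @^-1` `[0, +oo[) `&`
    (((fun p => p.2 - p.1) @^-1` `]0, +oo[) `&` (snd @^-1` `]-oo, 1])).
  apply/seteqP; split=> p /=; rewrite !in_itv /= !andbT subr_gt0.
    by move=> [? [? ?]].
  by move=> [? [? ?]].
apply: measurableI; last apply: measurableI.
- rewrite -[X in measurable X]setTI; apply: measurable_fst => //; exact: measurable_itv.
- rewrite -[X in measurable X]setTI.
  apply: (measurable_funB measurable_snd measurable_fst) => //; exact: measurable_itv.
- rewrite -[X in measurable X]setTI; apply: measurable_snd => //; exact: measurable_itv.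
Qed.

Lemma patch_Delta01 f p : @Delta01 R p -> (f \_ (@Delta01 R)) p = f p.
Proof. by move=> pD; rewrite patchE mem_set. Qed.

Lemma patch_notDelta01 f p : ~ @Delta01 R p -> (f \_ (@Delta01 R)) p = 0.
Proof. by move=> pD; rewrite patchE memNset. Qed.

(** Off Delta, the complement of the compact support is a neighbourhood on which the extension is 0.
    On Delta, the condition x < y is open, so nearby points of the square are again in Delta, where
    [f] is continuous. *)
Lemma Cc_Delta_locally_uniform f p e : Cc_Delta f -> unit_square p -> 0 < e ->
  \forall p' \near p, unit_square p' ->
    `|(f \_ (@Delta01 R)) p - (f \_ (@Delta01 R)) p'| <= e.
Proof.
move=> [fc [K [cK KD fK]]] sp e0.
have [pD|pD] := pselect (@Delta01 R p); last first.
  have nK : nbhs p (~` K).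
    apply: open_nbhs_nbhs; split; last by move/KD.
    by apply: closed_openC; apply: compact_closed cK; exact: norm_hausdorff.
  apply: filterS nK => p' p'K _; rewrite patch_notDelta01 // sub0r normrN.
  have [p'D|p'D] := pselect (@Delta01 R p'); last by rewrite patch_notDelta01 // normr0 ltW.
  by rewrite patch_Delta01 // fK // normr0 ltW.
have /subspace_continuousP/(_ p pD)/cvgrPdist_le/(_ _ e0) := fc.
rewrite /= near_withinE => near_p.
have lt_near : \forall p' \near p, p'.1 < p'.2.
  have : open [set p' : R * R | 0 < p'.2 - p'.1].
    apply: (@open_comp _ _ (fun p' : R * R => p'.2 - p'.1) [set x | 0 < x]); last exact: open_gt.
    by move=> p' _; apply: cvgB; [exact: cvg_snd|exact: cvg_fst].
  move=> op; have : nbhs p [set p' : R * R | 0 < p'.2 - p'.1].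
    by apply: open_nbhs_nbhs; split=> //=; case: pD => _ []; rewrite subr_gt0.
  by apply: filterS => p' /=; rewrite subr_gt0.
apply: filterS2 near_p lt_near => p' hp' p'12 sp'.
have p'D : @Delta01 R p' by have [/andP[h1 h2] /andP[h3 h4]] := sp'.
by rewrite !patch_Delta01 //; exact: hp'.
Qed.

Lemma compact_unit_square : compact (@unit_square R).
Proof.
have -> : @unit_square R = `[0, 1] `*` `[0, 1].
  by apply/seteqP; split=> p /=; rewrite !in_itv.
by apply: compact_setX; exact: segment_compact.
Qed.

(** Heine-Cantor on the compact square. Delta itself is not compact, hence the extension by zero. *)
Lemma Cc_Delta_modulus f : Cc_Delta f -> has_modulus (f \_ (@Delta01 R)).
Proof.
move=> fC e e0; have e2 : 0 < e / 2 by rewrite divr_gt0.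
set g := f \_ _.
pose Q (delta : R) p := unit_square p -> forall p', unit_square p' ->
  `|p.1 - p'.1| <= delta -> `|p.2 - p'.2| <= delta -> `|g p - g p'| <= e.
have : \forall delta \near 0^'+, @unit_square R `<=` Q delta.
  have /compact_near_coveringP := compact_unit_square; apply => p sp.
  have /nbhs_ballP[r /= r0 hr] := Cc_Delta_locally_uniform fC sp e2.
  have r2 : 0 < r / 2 by rewrite divr_gt0.
  exists (ball p (r / 2), [set delta | delta < r / 2]).
    split; [exact: nbhsx_ballx|exact: nbhs_right_lt].
  move=> [x delta] [/= px dr] sx p' sp' h1 h2.
  have {}hr p'' : ball p r p'' -> unit_square p'' -> `|g p - g p''| <= e / 2 := @hr p''.
  have px' : ball p r x by apply: le_ball px; lra.
  have hp' : ball p r p'.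
    move: px => [px1 px2]; move: px1 px2; rewrite /ball /= => px1 px2; split; rewrite /ball /=.
      have -> : p.1 - p'.1 = (p.1 - x.1) + (x.1 - p'.1) by rewrite addrA subrK.
      by apply: le_lt_trans (ler_normD _ _) _; lra.
    have -> : p.2 - p'.2 = (p.2 - x.2) + (x.2 - p'.2) by rewrite addrA subrK.
    by apply: le_lt_trans (ler_normD _ _) _; lra.
  have := hr p' hp' sp'; have := hr x px' sx.
  rewrite !ler_norml => /andP[a1 a2] /andP[b1 b2].
  by apply/andP; split; lra.
move=> near_Q; have [delta [delta0 hd]] := filter_ex (filterI (nbhs_right_gt 0) near_Q).
by exists delta => // p p' sp; exact: hd.
Qed.

(** Boxes are open below and closed above, to match quadrants x <= sigma, y > tau. Index 0 catches
    the coordinate 0, so the indices 0 to N partition [0, 1]. *)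
Definition grid_box N j k p : bool :=
  ((j%:R - 1) / N%:R < p.1 <= j%:R / N%:R) && ((k%:R - 1) / N%:R < p.2 <= k%:R / N%:R).

(** For j < k the box lies strictly above the diagonal, where Betti numbers determine its count. For
    the other boxes the corner is off Delta, where the functions at hand vanish. *)
Definition grid_value g N j k : R := if (j < k)%N then g (j%:R / N%:R, k%:R / N%:R) else 0.

Definition grid_step g N p : R :=
  \sum_(j < N.+1) \sum_(k < N.+1) grid_value g N j k * (grid_box N j k p)%:R.

Lemma grid_index N (x : R) : (0 < N)%N -> 0 <= x <= 1 -> exists2 j, (j <= N)%N &
  forall j', ((j'%:R - 1) / N%:R < x <= j'%:R / N%:R) = (j' == j).
Proof.
move=> N0 /andP[x0 x1]; have NR : 0 < N%:R :> R by rewrite ltr0n.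
have [j /andP[j1 j2]] := exists_nat_ceil (mulr_ge0 x0 (ltW NR)).
exists j.
  rewrite -ltnS -(ltr_nat R) -natr1; apply: lt_le_trans j2 _.
  by rewrite lerD2r ler_piMl // ltW.
move=> j'; rewrite ltr_pdivrMr // ler_pdivlMr // ltrBlDr.
apply/andP/eqP => [[h1 h2]|->]; last by [].
have a : (j < j'.+1)%N.
  by rewrite -(ltr_nat R) -natr1; apply: lt_le_trans j2 _; rewrite lerD2r.
have b : (j' < j.+1)%N by rewrite -(ltr_nat R) -(@natr1 _ j); apply: lt_le_trans h1 _; rewrite lerD2r.
by apply/eqP; rewrite eqn_leq; apply/andP; split; rewrite -ltnS.
Qed.

Lemma grid_approx g e : has_modulus g -> (forall p, ~ @Delta01 R p -> g p = 0) -> 0 < e ->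
  exists2 N, (0 < N)%N & forall p, unit_square p -> `|g p - grid_step g N p| <= e.
Proof.
move=> gmod g0 e0; have [delta d0 hd] := gmod _ e0.
pose N := (Num.truncn delta^-1).+1.
have Nd : delta^-1 < N%:R by rewrite /N truncnS_gt.
have NR : 0 < N%:R :> R by rewrite ltr0n.
have iNd : N%:R^-1 < delta by rewrite invf_plt ?posrE.
exists N => // p sp; have [p1 p2] := sp.
have [j jN hj] := @grid_index N p.1 isT p1; have [k kN hk] := @grid_index N p.2 isT p2.
have -> : grid_step g N p = g (j%:R / N%:R, k%:R / N%:R).
  rewrite /grid_step (bigD1 (Ordinal (jN : (j < N.+1)%N))) //= (bigD1 (Ordinal (kN : (k < N.+1)%N))) //=.
  rewrite /grid_box hj hk !eqxx mulr1 !big1 ?addr0 => [|j' j'j|k' k'k].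
  - rewrite /grid_value; case: ltnP => // kj; rewrite g0 // => -[_ [/=]].
    by rewrite ltr_pM2r ?invr_gt0 // ltr_nat ltnNge kj.
  - rewrite big1 // => k' _; rewrite hj (_ : (j' : nat) == j = false) ?mulr0 //.
    by apply: contraNF j'j => /eqP jj; apply/eqP/val_inj.
  - rewrite hk (_ : (k' : nat) == k = false) ?mulr0 //.
    by apply: contraNF k'k => /eqP kk; apply/eqP/val_inj.
have := hj j; have := hk k; rewrite !eqxx !mulrBl !mul1r => /andP[k1 k2] /andP[j1 j2].
have in01 i : (i <= N)%N -> 0 <= i%:R / N%:R <= (1 : R).
  by move=> iN; rewrite divr_ge0 //= ler_pdivrMr // mul1r ler_nat.
by apply: hd; rewrite //= ?ler_norml; [split; exact: in01| |]; apply/andP; split; lra.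
Qed.

Lemma measurable_grid_box N j k : measurable_fun setT (fun p => (grid_box N j k p)%:R : R).
Proof.
have -> : (fun p => (grid_box N j k p)%:R : R) = \1_[set p | grid_box N j k p].
  by apply/funext => p; rewrite indicE mem_setE.
apply: measurable_indic.
rewrite (_ : [set p | _] = (fst @^-1` `](j%:R - 1) / N%:R, j%:R / N%:R]) `&`
   (snd @^-1` `](k%:R - 1) / N%:R, k%:R / N%:R])).
  apply: measurableI; rewrite -[X in measurable X]setTI.
    by apply: measurable_fst => //; exact: measurable_itv.
  by apply: measurable_snd => //; exact: measurable_itv.
by apply/seteqP; split=> p /=; rewrite !in_itv /grid_box => /andP.
Qed.

Lemma measurable_has_modulus g : has_modulus g -> (forall p, ~ @Delta01 R p -> g p = 0) ->
  measurable_fun setT g.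
Proof.
move=> gmod g0.
have /choice[N hN] n : exists N, forall p, unit_square p ->
    `|g p - grid_step g N p| <= harmonic n.
  by have [N _ hN] := grid_approx gmod g0 (harmonic_gt0 n); exists N.
(* The indicator of Delta is inserted because grid steps are close to [g] on the unit square
   only. *)
apply: (@measurable_fun_cvg _ _ _ _ (fun n p => grid_step g (N n) p * \1_(@Delta01 R) p)) => [n|p _].
  apply: measurable_funM; last by apply: measurable_indic; exact: measurable_Delta01.
  apply: measurable_sum => j; apply: measurable_sum => k; apply: measurable_funM => //.
  exact: measurable_grid_box.
have [pD|pD] := pselect (@Delta01 R p); last first.
  rewrite g0 // indicE memNset //; under eq_fun do rewrite mulr0; exact: cvg_cst.
rewrite indicE mem_set //; under eq_fun do rewrite mulr1.
apply/cvgrPdist_le => e e0.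
have /cvgrPdist_le/(_ _ e0) := @cvg_harmonic R.
apply: filterS => n; rewrite sub0r normrN ger0_norm ?harmonic_ge0 // => he.
by apply: le_trans (hN n p (sub_Delta01_square pD)) he.
Qed.

Definition box_count N j k (l : seq (R * R)) : R := \sum_(p <- l) (grid_box N j k p)%:R.

Lemma sum_grid_step g N (l : seq (R * R)) : \sum_(p <- l) grid_step g N p =
  \sum_(j < N.+1) \sum_(k < N.+1) grid_value g N j k * box_count N j k l.
Proof.
rewrite exchange_big; apply: eq_bigr => j _; rewrite exchange_big; apply: eq_bigr => k _.
by rewrite -mulr_sumr.
Qed.

Lemma sum_grid_approx g e N (l : seq (R * R)) : (forall p, p \in l -> unit_square p) ->
  (forall p, unit_square p -> `|g p - grid_step g N p| <= e) ->
  `|\sum_(p <- l) g p - \sum_(p <- l) grid_step g N p| <= e * (size l)%:R.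
Proof.
move=> lsq ge; rewrite -sumrB; apply: (le_trans (ler_norm_sum _ _ _)).
rewrite mulr_natr -[size _]count_predT -sum1_count -sumrMnr big_seq [leRHS]big_seq.
by apply: ler_sum => p pl; rewrite mulr1n; apply/ge/lsq.
Qed.

Definition quadrant_count (sigma tau : R) (l : seq (R * R)) : nat :=
  count (fun p => (p.1 <= sigma) && (tau < p.2)) l.

Lemma box_countE N j k (l : seq (R * R)) : box_count N j k l =
  (quadrant_count (j%:R / N%:R) ((k%:R - 1) / N%:R) l)%:R
  - (quadrant_count ((j%:R - 1) / N%:R) ((k%:R - 1) / N%:R) l)%:R
  - (quadrant_count (j%:R / N%:R) (k%:R / N%:R) l)%:R
  + (quadrant_count ((j%:R - 1) / N%:R) (k%:R / N%:R) l)%:R.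
Proof.
have le1 (i : nat) : (i%:R - 1) / N%:R <= i%:R / N%:R :> R.
  by rewrite ler_wpM2r ?invr_ge0 // gerBl.
rewrite /box_count /quadrant_count -!sum1_count !natr_sum !(big_mkcond (fun p => _ && _)) /=.
rewrite -!sumrB -big_split /=; apply: eq_bigr => p _; rewrite /grid_box.
have := le1 j; have := le1 k.
move: (j%:R / N%:R) ((j%:R - 1) / N%:R) (k%:R / N%:R) ((k%:R - 1) / N%:R) => s2 s1 t2 t1 t12 s12.
have [a1|a1] := leP p.1 s1; have [a2|a2] := leP p.1 s2; have [b1|b1] := ltP t1 p.2;
  have [b2|b2] := ltP t2 p.2; rewrite /= ?subrr ?subr0 ?addr0 ?sub0r ?subrK //; try lra.
Qed.

End Grid.

(** * Strong law for persistence diagrams *)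

Section DiagramPoints.
Context (R : realType) (d : nat).
Implicit Types (tb : cube d -> \bar R) (p : \bar R * \bar R).

Lemma phiE_le (x : \bar R) (sigma : R) : (0 <= x)%E -> 0 <= sigma < 1 ->
  (phiE x <= sigma) = (x <= (sigma / (1 - sigma))%:E)%E.
Proof.
move=> x0 /andP[s0 s1]; have s1' : 0 < 1 - sigma by rewrite subr_gt0.
case: x x0 => [r| |//]; last first.
  by move=> _; rewrite leye_eq /= leNgt s1.
rewrite !lee_fin /= => r0; rewrite ler_pdivrMr ?ltr_wpDr // ler_pdivlMr //.
by apply/idP/idP => h; lra.
Qed.

Lemma phiE_gt (x : \bar R) (tau : R) : (0 <= x)%E -> 0 <= tau < 1 ->
  (tau < phiE x) = ((tau / (1 - tau))%:E < x)%E.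
Proof. by move=> x0 t01; rewrite !ltNge phiE_le. Qed.

Lemma toDelta01_Delta p : in_Delta p -> Delta01 (toDelta01 p).
Proof.
case: p => [[r| |] [r'| |]] [] //=; rewrite ?lee_fin ?lte_fin ?ltxx // => r0 rr'.
  have r0' : 0 <= r' by rewrite (le_trans r0) // ltW.
  split; rewrite /= ?divr_ge0 ?addr_ge0 //; split; last first.
    by rewrite ler_pdivrMr ?ltr_wpDr // mul1r lerDr.
  rewrite ltr_pdivrMr ?ltr_wpDr // mulrAC ltr_pdivlMr ?ltr_wpDr //; lra.
split; rewrite /= ?divr_ge0 ?addr_ge0 //; split=> //.
by rewrite ltr_pdivrMr ?ltr_wpDr // mul1r ltrDr.
Qed.

Definition diagram_points tb n q : seq (R * R) := map (@toDelta01 R) (pers_diagram tb n q).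

Lemma diagram_points_Delta tb n q (p : R * R) : (forall Q, (0 <= tb Q)%E) ->
  p \in diagram_points tb n q -> Delta01 p.
Proof.
move=> tb0 /mapP[p' p'D ->]; apply: toDelta01_Delta.
by have [h _] := pers_diagramP n q tb0; exact: h.
Qed.

Lemma size_diagram_points tb n q : (forall Q, (0 <= tb Q)%E) ->
  (size (diagram_points tb n q) <= (4 * n).+1 ^ d)%N.
Proof.
by move=> tb0; rewrite size_map -nboxE; exact/size_is_pers_diagram/pers_diagramP.
Qed.

(** Test functions are constrained on Delta only; all diagram points lie there, so the extension by
    zero has the same integral. *)
Lemma diag_integralE tb n q (f : R * R -> R) : (forall Q, (0 <= tb Q)%E) ->
  diag_integral (pers_diagram tb n q) f =
  \sum_(p <- diagram_points tb n q) (f \_ (@Delta01 R)) p.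
Proof.
move=> tb0; rewrite /diag_integral big_map big_seq [RHS]big_seq; apply: eq_bigr => p pD.
by rewrite patch_Delta01 //; apply: (diagram_points_Delta tb0); apply: map_f pD.
Qed.

(** sigma / (1 - sigma) inverts the homeomorphism. The excluded values do occur, as (j - 1)/N for j
    = 0 and k/N for k = N; their quadrants miss Delta. *)
Lemma quadrant_count_diagram tb n q (sigma tau : R) : (forall Q, (0 <= tb Q)%E) ->
  sigma <= tau -> quadrant_count sigma tau (diagram_points tb n q) =
  if (0 <= sigma) && (tau < 1)
  then pers_betti tb n q (sigma / (1 - sigma)) (tau / (1 - tau)) else 0%N.
Proof.
move=> tb0 st; case: ifPn => [/andP[s0 t1]|]; last first.
  rewrite negb_and -ltNge -leNgt => st'; apply/eqP; rewrite -leqn0 leqNgt -has_count.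
  apply/negP => /hasP[p /(diagram_points_Delta tb0)[p0 [p12 p1]] /andP[ps tp]].
  by case/orP: st' => h; lra.
have s1 : sigma < 1 by exact: le_lt_trans t1.
have t0 : 0 <= tau by exact: le_trans st.
have [hD hcount] := pers_diagramP n q tb0.
rewrite -hcount; last 2 first.
- by rewrite divr_ge0 // subr_ge0 ltW.
- rewrite ler_pdivrMr ?subr_gt0 // mulrAC ler_pdivlMr ?subr_gt0 //; lra.
rewrite /quadrant_count count_map; apply: eq_in_count => p /hD[p0 p12] /=.
by rewrite phiE_le ?s0 // phiE_gt ?t0 // (le_trans p0) // ltW.
Qed.

End DiagramPoints.

Section DiagramLLN.
Context (R : realType) (dT : measure_display) (T : measurableType dT) (P : probability T R).
Context (d : nat) (X : T -> cube d -> \bar R) (Rd q : nat).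
Hypothesis Xrcf : random_cubical_filtration P X.
Hypothesis Xstat : stationary P X.
Hypothesis Xdep : R_dependent P X Rd.
Hypothesis d0 : (0 < d)%N.

Let X0 w Q : (0 <= X w Q)%E := (Xrcf.1 w).1 Q.

Local Notation pts w n := (diagram_points (X w) n q).
Local Notation vol n := (box_vol R d n).

Let pts_square w n p : p \in pts w n -> unit_square p.
Proof. by move=> /(diagram_points_Delta (X0 w)); exact: sub_Delta01_square. Qed.

(** The constant comes from 4n + 1 <= 3 (2n) for n > 0. For n = 0 the volume is 0, as d > 0, and so
    is its inverse by convention. *)
Let mass_le w n : (vol n)^-1 * (size (pts w n))%:R <= 3 ^+ d.
Proof.
have [->|n0] := posnP n.
  by rewrite /box_vol double0 exp0n // invr0 mul0r exprn_ge0.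
have v0 : 0 < vol n by rewrite ltr0n expn_gt0 double_gt0 n0.
rewrite mulrC ler_pdivrMr // /box_vol -natrX -natrM ler_nat -expnMn.
apply: leq_trans (size_diagram_points n q (X0 w)) _; rewrite leq_exp2r //; lia.
Qed.

Lemma quadrant_count_lln (sigma tau : R) : sigma <= tau -> exists a : R, {ae P, forall w,
  (fun n => (quadrant_count sigma tau (pts w n))%:R / vol n) @ \oo --> a}.
Proof.
move=> st; have [h|h] := boolP ((0 <= sigma) && (tau < 1)).
  have [a ha] := pers_betti_lln q (sigma / (1 - sigma)) (tau / (1 - tau)) Xrcf Xstat Xdep d0.
  exists a; apply: filterS ha => w; rewrite (_ : (fun n => _) = (fun n => (quadrant_count sigma tau (pts w n))%:R / vol n)) //.
  by apply/funext => n; rewrite quadrant_count_diagram // h.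
exists 0; apply: aeW => w.
rewrite (_ : (fun n => _) = fun=> 0); first exact: cvg_cst.
by apply/funext => n; rewrite quadrant_count_diagram // (negPf h) mul0r.
Qed.

Let measurable_quadrant_count (sigma tau : R) n : sigma <= tau ->
  measurable_fun setT (fun w => (quadrant_count sigma tau (pts w n))%:R : R).
Proof.
move=> st; have [h|h] := boolP ((0 <= sigma) && (tau < 1)).
  rewrite (_ : (fun w => _) = (fun w => (pers_betti (X w) n q (sigma / (1 - sigma)) (tau / (1 - tau)))%:R : R)).
    exact: (measurable_pers_betti q _ _ Xrcf n).
  by apply/funext => w; rewrite quadrant_count_diagram // h.
rewrite (_ : (fun w => _) = cst 0); first exact: measurable_cst.
by apply/funext => w; rewrite quadrant_count_diagram // (negPf h).
Qed.

(* For [j < k] the box lies above the diagonal, so its mass is a combination of values of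
   persistent Betti numbers. *)
Let box_corners N j k : (j < k)%N ->
  [/\ j%:R / N%:R <= (k%:R - 1) / N%:R :> R, (j%:R - 1) / N%:R <= (k%:R - 1) / N%:R :> R,
      j%:R / N%:R <= k%:R / N%:R :> R & (j%:R - 1) / N%:R <= k%:R / N%:R :> R].
Proof.
move=> jk; have jkR : j%:R + 1 <= k%:R :> R by rewrite natr1 ler_nat.
by split; rewrite ler_wpM2r ?invr_ge0 //; lra.
Qed.

Lemma box_count_lln N j k : (j < k)%N -> exists a : R, {ae P, forall w,
  (fun n => box_count N j k (pts w n) / vol n) @ \oo --> a}.
Proof.
move=> /(box_corners N)[/quadrant_count_lln[a1 h1] /quadrant_count_lln[a2 h2]
  /quadrant_count_lln[a3 h3] /quadrant_count_lln[a4 h4]].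
exists (a1 - a2 - a3 + a4).
apply: filterS2 (filterI h1 h2) (filterI h3 h4) => w [c1 c2] [c3 c4].
under eq_fun do rewrite box_countE mulrDl mulrBl [in X in X - _]mulrBl.
by apply: cvgD => //; apply: cvgB => //; apply: cvgB.
Qed.

Let measurable_box_count N j k n : (j < k)%N ->
  measurable_fun setT (fun w => box_count N j k (pts w n)).
Proof.
move=> /(box_corners N)[h1 h2 h3 h4]; under eq_fun do rewrite box_countE.
apply: measurable_funD; last exact: measurable_quadrant_count.
apply: measurable_funB; last exact: measurable_quadrant_count.
by apply: measurable_funB; exact: measurable_quadrant_count.
Qed.

Lemma measurable_sum_grid_step g N n :
  measurable_fun setT (fun w => \sum_(p <- pts w n) grid_step g N p).
Proof.
under eq_fun do rewrite sum_grid_step.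
apply: measurable_sum => j; apply: measurable_sum => k.
rewrite /grid_value; case: ltnP => [jk|_].
  by apply: measurable_funM; [exact: measurable_cst|exact: measurable_box_count].
by under eq_fun do rewrite mul0r; exact: measurable_cst.
Qed.

(** The diagram is picked by a choice operator, so measurability in [w] has to pass through grid
    counts, which are combinations of persistent Betti numbers. *)
Lemma measurable_diag_integral f n : Cc_Delta f ->
  measurable_fun setT (fun w => diag_integral (pers_diagram (X w) n q) f).
Proof.
move=> fC; have gmod := Cc_Delta_modulus fC; set g := f \_ _ in gmod.
have g0 p : ~ @Delta01 R p -> g p = 0 by exact: patch_notDelta01.
have /choice[N hN] m : exists N, forall p, unit_square p ->
    `|g p - grid_step g N p| <= harmonic m.
  by have [N _ hN] := grid_approx gmod g0 (harmonic_gt0 m); exists N.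
apply: (@measurable_fun_cvg _ _ _ _ (fun m w => \sum_(p <- pts w n) grid_step g (N m) p)) => [m|w _].
  exact: measurable_sum_grid_step.
rewrite diag_integralE // -/g; apply/cvgrPdist_le => e e0.
have K0 : 0 < (size (pts w n))%:R + 1 :> R by rewrite ltr_wpDl.
have e1 : 0 < e / ((size (pts w n))%:R + 1) by rewrite divr_gt0.
have /cvgrPdist_le/(_ _ e1) := @cvg_harmonic R.
apply: filterS => m; rewrite sub0r normrN ger0_norm ?harmonic_ge0 // => he.
apply: le_trans (sum_grid_approx (@pts_square w n) (hN m)) _.
apply: (@le_trans _ _ (e / ((size (pts w n))%:R + 1) * (size (pts w n))%:R)).
  by rewrite ler_wpM2r.
by rewrite mulrAC ler_pdivrMr // ler_wpM2l ?(ltW e0) // lerDl.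
Qed.

(** One [N] serves all samples and all n, because the normalized diagrams have mass at most 3^d. *)
Lemma grid_approx_diagram f e : Cc_Delta f -> 0 < e -> exists2 N, (0 < N)%N & forall w n,
  `|diag_integral (pers_diagram (X w) n q) f / vol n
    - \sum_(j < N.+1) \sum_(k < N.+1) grid_value (f \_ (@Delta01 R)) N j k *
         (box_count N j k (pts w n) / vol n)| <= e.
Proof.
move=> fC e0; have gmod := Cc_Delta_modulus fC; set g := f \_ _ in gmod *.
have g0 p : ~ @Delta01 R p -> g p = 0 by exact: patch_notDelta01.
have e3 : 0 < e / 3 ^+ d by rewrite divr_gt0 // exprn_gt0.
have [N N0 hN] := grid_approx gmod g0 e3; exists N => // w n.
rewrite diag_integralE // -/g.
have -> : \sum_(j < N.+1) \sum_(k < N.+1) grid_value g N j k * (box_count N j k (pts w n) / vol n) =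
    (\sum_(p <- pts w n) grid_step g N p) / vol n.
  rewrite sum_grid_step mulr_suml; apply: eq_bigr => j _.
  by rewrite mulr_suml; apply: eq_bigr => k _; rewrite mulrA.
have v0 : 0 <= (vol n)^-1 by rewrite invr_ge0.
rewrite -mulrBl normrM (ger0_norm v0).
apply: (le_trans (ler_wpM2r v0 (sum_grid_approx (@pts_square w n) hN))).
have -> : e / 3 ^+ d * (size (pts w n))%:R / vol n =
    e / 3 ^+ d * ((vol n)^-1 * (size (pts w n))%:R) by rewrite mulrAC mulrA.
apply: (le_trans (ler_wpM2l (ltW e3) (mass_le w n))).
by rewrite divfK // gt_eqF // exprn_gt0.
Qed.

Let grid_sum f N w n : R :=
  \sum_(j < N.+1) \sum_(k < N.+1) grid_value (f \_ (@Delta01 R)) N j k *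
     (box_count N j k (pts w n) / vol n).

Let grid_limit (a : nat -> nat -> nat -> R) f N : R :=
  \sum_(j < N.+1) \sum_(k < N.+1) grid_value (f \_ (@Delta01 R)) N j k * a N j k.

Let grid_good a w := forall N j k : nat, (j < k)%N ->
  (fun n => box_count N j k (pts w n) / vol n) @ \oo --> (a N j k : R).

(** Only countably many triples (N, j, k) are involved, so a single null set is discarded before any
    test function is chosen. *)
Let ae_grid_lln : exists a : nat -> nat -> nat -> R, {ae P, forall w, grid_good a w}.
Proof.
have /choice[a ha] (x : nat * nat * nat) : exists a : R, {ae P, forall w, (x.1.2 < x.2)%N ->
    (fun n => box_count x.1.1 x.1.2 x.2 (pts w n) / vol n) @ \oo --> a}.
  have [lt|ge] := ltnP x.1.2 x.2; last by exists 0; apply: aeW => w.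
  by have [a ha] := box_count_lln x.1.1 lt; exists a; apply: filterS ha => w hw _.
exists (fun N j k => a (N, j, k)).
have : {ae P, forall w, forall x : nat * nat * nat, (x.1.2 < x.2)%N ->
    (fun n => box_count x.1.1 x.1.2 x.2 (pts w n) / vol n) @ \oo --> a x}.
  exact: ae_forall_countable.
by apply: filterS => w hw N j k; exact: (hw (N, j, k)).
Qed.


Let grid_sum_cvg a f N w : grid_good a w -> grid_sum f N w @ \oo --> grid_limit a f N.
Proof.
move=> wa; apply: cvgr_sum => j; apply: cvgr_sum => k.
rewrite /grid_value; case: ltnP => jk.
  by apply: cvgM; [exact: cvg_cst|exact: wa].
by rewrite mul0r; under eq_fun do rewrite mul0r; exact: cvg_cst.
Qed.

Lemma exists_limit_measure : exists xi : {measure set (R * R) -> \bar R},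
  radon_Delta xi /\
  {ae P, forall w, forall f, Cc_Delta f -> exists2 I : R,
    (\int[xi]_(x in @Delta01 R) (f x)%:E)%E = I%:E &
    (fun n => diag_integral (pers_diagram (X w) n q) f / vol n) @ \oo --> I}.
Proof.
have [a ae_a] := ae_grid_lln.
have [w0 w0a] : exists w, grid_good a w.
  have PF : ProperFilter (almost_everywhere P).
    apply: ae_properfilter_algebraOfSetsType.
    by apply: (@lt_le_trans _ _ 1%E) => //; rewrite -(@probability_setT _ _ _ P).
  exact: filter_ex ae_a.
have vol0 n : 0 <= (vol n)^-1 by rewrite invr_ge0.
have [G [nu [GF ooG nu_lty nu_int]]] :=
  exists_weak_limit vol0 (mass_le w0) (@pts_square w0).
(* Restriction to Delta drops the mass that accumulates on the diagonal as well as the infinite mass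
   at (0, 0). *)
pose mD := @measurable_Delta01 R; pose xi := mrestr nu mD.
exists xi; split; [split|].
- by rewrite /xi /= /mrestr setICl measure0.
- move=> K _ KD; apply: nu_lty => -[/KD K0 _]; exact: Delta01_0 K0.
apply: filterS ae_a => w wa f fC.
have gmod := Cc_Delta_modulus fC.
have [I cI intI] := nu_int _ _ mD (@Delta01_0 R)
  (measurable_has_modulus gmod (@patch_notDelta01 _ f)) gmod (@patch_notDelta01 _ f).
exists I.
  rewrite -intI (@eq_measure_integral _ _ _ (@Delta01 R) nu) => [|A mA AD].
    by apply: eq_integral => x; rewrite inE => xD; rewrite patch_Delta01.
  by rewrite /xi /= /mrestr (setIidl AD).
have cG : (fun n => diag_integral (pers_diagram (X w0) n q) f / vol n) @ G --> I.
  rewrite (_ : (fun n => _) = fun n => (vol n)^-1 * \sum_(p <- pts w0 n) (f \_ (@Delta01 R)) p) //.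
  by apply/funext => n; rewrite diag_integralE // mulrC.
apply/cvgrPdist_le => e e0; have e4 : 0 < e / 8 by rewrite divr_gt0.
have [N N0 hN] := grid_approx_diagram fC e4.
(* The samples [w0] and [w] meet at [grid_limit]: [w0] reaches it along [\oo], hence along [G],
   where its integrals tend to [I]. *)
have near_limit : `|I - grid_limit a f N| <= e / 2.
  move/cvgrPdist_le : cG => /(_ _ e4) cG.
  have /cvgrPdist_le/(_ _ e4)/ooG cS := @grid_sum_cvg a f N w0 w0a.
  have [n [n1 n2]] := filter_ex (filterI cG cS); have := hN w0 n; move: n1 n2.
  rewrite -/(grid_sum f N w0 n) /= !ler_norml => /andP[h1 h2] /andP[h3 h4] /andP[h5 h6].
  by apply/andP; split; lra.
have /cvgrPdist_le/(_ _ e4) := @grid_sum_cvg a f N w wa.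
apply: filterS => n; have := hN w n; move: near_limit.
rewrite -/(grid_sum f N w n) !ler_norml => /andP[h1 h2] /andP[h3 h4] /andP[h5 h6].
by apply/andP; split; lra.
Qed.

Lemma diag_integral_bounded f : Cc_Delta f -> exists2 B : R, 0 <= B & forall w n,
  `|diag_integral (pers_diagram (X w) n q) f / vol n| <= B.
Proof.
move=> fC; have [B B0 hB] := has_modulus_bounded (Cc_Delta_modulus fC).
exists (B * 3 ^+ d) => [|w n]; first by rewrite mulr_ge0 ?exprn_ge0 // ltW.
have v0 : 0 <= (vol n)^-1 by rewrite invr_ge0.
rewrite diag_integralE // normrM (ger0_norm v0).
apply: (@le_trans _ _ (B * (size (pts w n))%:R * (vol n)^-1)).
  rewrite ler_wpM2r //; apply: (le_trans (ler_norm_sum _ _ _)).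
  rewrite mulr_natr -[size _]count_predT -sum1_count -sumrMnr big_seq [leRHS]big_seq.
  by apply: ler_sum => p /pts_square sp; rewrite mulr1n hB.
by rewrite -mulrA [_%:R * _]mulrC ler_wpM2l // ltW.
Qed.

Lemma expectation_diag_integral_cvg f (I : R) : Cc_Delta f ->
  {ae P, forall w, (fun n => diag_integral (pers_diagram (X w) n q) f / vol n) @ \oo --> I} ->
  (fun n : nat => ('E_P[fun w => diag_integral (pers_diagram (X w) n q) f]
                         * (vol n)^-1%:E)%E) @ \oo --> I%:E.
Proof.
move=> fC cI; have [B B0 hB] := diag_integral_bounded fC.
have mF n : measurable_fun setT (fun w => diag_integral (pers_diagram (X w) n q) f / vol n).
  by apply: measurable_funM; [exact: measurable_diag_integral|exact: measurable_cst].
rewrite (_ : (fun n => _) = (fun n => (\int[P]_w (diag_integral (pers_diagram (X w) n q) f / vol n)%:E)%E)); last first.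
  apply/funext => n; rewrite unlock.
  (* The volume is 0 at n = 0; both sides are then 0 since the inverse of 0 is 0. *)
  have [v0|v0] := eqVneq (vol n) 0.
    rewrite v0 invr0 mule0; under eq_integral do rewrite mulr0.
    by rewrite integral0.
  under [in RHS]eq_integral do rewrite EFinM.
  rewrite integralZr //; apply: measurable_bounded_integrable => //.
  - by apply: (@le_lt_trans _ _ 1%E); [exact: probability_le1|exact: ltry].
  - exact: measurable_diag_integral.
  exists (B * `|vol n|); split; first exact: num_real.
  move=> x Bx w _; apply: le_trans (ltW Bx).
  by rewrite -[diag_integral _ _](divfK v0) normrM ler_wpM2r.
have [] := @dominated_convergence _ T R P setT measurableT
  (fun n w => (diag_integral (pers_diagram (X w) n q) f / vol n)%:E) (cst I%:E) (cst B%:E).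
- by move=> n; apply/measurable_EFinP.
- exact: measurable_cst.
- by apply: filterS cI => w hw _; apply: cvg_EFin; [exact: nearW|exact: hw].
- exact: finite_measure_integrable_cst.
- by apply: aeW => w n _; rewrite lee_fin.
move=> _ _; rewrite integral_cst // [X in (_ * X)%E](@probability_setT _ _ _ P) mule1.
exact.
Qed.

End DiagramLLN.

Theorem mainTheorem2 (R : realType) (dT : measure_display) (T : measurableType dT)
  (P : probability T R) (d : nat) (X : T -> cube d -> \bar R) (Rd q : nat) :
  random_cubical_filtration P X -> stationary P X -> R_dependent P X Rd ->
  (q < d)%N ->
  exists xi : {measure set (R * R) -> \bar R},
    radon_Delta xi /\
    (forall f : R * R -> R, Cc_Delta f ->
       (fun n : nat => ('E_P[fun w => diag_integral (pers_diagram (X w) n q) f]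
                         * (box_vol R d n)^-1%:E)%E)
       @ \oo --> (\int[xi]_(x in @Delta01 R) (f x)%:E)%E) /\
    {ae P, forall w, forall f : R * R -> R, Cc_Delta f ->
       (fun n : nat => (diag_integral (pers_diagram (X w) n q) f / box_vol R d n)%:E)
       @ \oo --> (\int[xi]_(x in @Delta01 R) (f x)%:E)%E}.
Proof.
move=> Xrcf Xstat Xdep qd; have d0 : (0 < d)%N by exact: leq_ltn_trans qd.
have [xi [xi_radon xi_lim]] := exists_limit_measure q Xrcf Xstat Xdep d0.
exists xi; split=> //; split; last first.
  apply: filterS xi_lim => w hw f /hw[I -> cI].
  by apply: cvg_EFin; [exact: nearW|exact: cI].
move=> f fC.
(* One good sample suffices to know that the integral against [xi] is a finite real number. *)
have [w0 /(_ f fC)[I intI _]] : exists w, forall f, Cc_Delta f -> exists2 I : R,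
    (\int[xi]_(x in @Delta01 R) (f x)%:E)%E = I%:E &
    (fun n => diag_integral (pers_diagram (X w) n q) f / box_vol R d n) @ \oo --> I.
  have PF : ProperFilter (almost_everywhere P).
    apply: ae_properfilter_algebraOfSetsType.
    by apply: (@lt_le_trans _ _ 1%E) => //; rewrite -(@probability_setT _ _ _ P).
  exact: filter_ex xi_lim.
rewrite intI; apply: expectation_diag_integral_cvg => //.
apply: filterS xi_lim => w /(_ f fC)[I']; rewrite intI => -[->].
exact.
Qed.
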